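(* Let $n\ge 1$. Call a word $w=w_1\cdots w_{n^2}$ in the alphabet $\{1,\dots,n\}$ a square word if each letter $1,\dots,n$ occurs exactly $n$ times and, for every prefix $w_1\cdots w_i$ and every $1\le j\le n-1$, the prefix contains at least as many letters $j+1$ as letters $j$. For a word $w=w_1w_2\cdots w_l$ let $\widehat w=w_2\cdots w_l$, and let $\overline{e}=e_1e_2\cdots e_{n-1}$ be the composite operator which applies $e_{n-1}$ first, then $e_{n-2}$, and so on down to $e_1$. Then for every square word $w$: (1) $p(Q(w))=Q(\overline{e}(\widehat w)\,1)$; (2) $p(Q'(w))=Q'(\overline{e}(\widehat w)\,1)$; and consequently, for every $Q\in SYT(n^n)$, $p(H(Q))=H(p(Q))$. Here $\overline{e}(\widehat w)\,1$ denotes the word $\overline{e}(\widehat w)$ with the letter $1$ appended at the end.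
   Context: $SYT(n^n)$ is the set of standard Young tableaux of square $n\times n$ shape (English notation, entries $1,\dots,n^2$); $SYT'(2n-1,2n-3,\dots,1)$ is the set of standard shifted Young tableaux of shifted ''doubled staircase'' shape, whose row $i$ ($1\le i\le n$) occupies columns $i,\dots,2n-i$. Promotion $p$ (on standard tableaux of a fixed straight or shifted shape with $N$ boxes): remove the entry $1$ from the box $(1,1)$ and decrease all other entries by $1$; then repeatedly slide the empty box: if there is a box to its right or below it, move into the empty box the smaller of the entries immediately right and immediately below (within the shape), and the empty box moves to where that entry was; stop when there is no box to the right or below; finally fill the empty box with $N$. $Q(w)$ is the recording tableau of Robinson–Schensted–Knuth (row) insertion of the word $w$. $Q'(w)$ is the recording tableau of (semistandard shifted) mixed insertion of $w$ (Haiman, Serrano); it is known to equal the standard shifted tableau obtained by viewing $Q(w)$ as a skew shifted standard tableau and rectifying it by shifted jeu de taquin (independent of choices). Haiman's map $H:SYT(n^n)\to SYT'(2n-1,2n-3,\dots,1)$: place $Q\in SYT(n^n)$ into the skew shifted shape whose row $i$ ($1\le i\le n$) occupies columns $n,\dots,2n-1$ inside the shifted diagram with rows $i$ occupying columns $i,\dots,2n-1$ (the cells in columns $i,\dots,n-1$ of row $i$ being empty), and rectify by shifted jeu de taquin slides into the empty cells; the result is $H(Q)$. (For a square word $w$, $H(Q(w))=Q'(w)$.) The crystal operator $e_j$ on words: consider the subword of letters $j$ and $j+1$; regard each $j+1$ as an opening bracket and each $j$ as a closing bracket and successively pair matched brackets; the unpaired letters form a subword $j^r(j+1)^s$; $e_j$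 changes this subword to $j^{r-1}(j+1)^{s+1}$ (i.e., changes the rightmost unpaired $j$ into $j+1$), leaving all other letters unchanged. *)

(* Defs.v *)
From mathcomp Require Import all_boot.

Set Implicit Arguments.
Unset Strict Implicit.
Unset Printing Implicit Defensive.

(* Rows and columns are numbered from 0 (so the box (1,1) is (0,0)); [None]
   means that there is no box, or that the box is empty.  Shifted tableaux are
   fillings with no box strictly below the diagonal. *)
Definition filling := nat -> nat -> option nat.

Definition set_box (T : filling) (i j : nat) (v : option nat) : filling :=
  fun a b => if (a == i) && (b == j) then v else T a b.

Record standard (D : rel nat) (N : nat) (T : filling) : Prop := Standard {
  standard_shape : forall i j, isSome (T i j) = D i j;
  standard_range : forall i j k, T i j = Some k -> 1 <= k <= N;
  standard_surj : forall k, 1 <= k <= N -> exists i j, T i j = Some k;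
  standard_inj : forall i j i' j' k,
    T i j = Some k -> T i' j' = Some k -> i = i' /\ j = j';
  standard_row : forall i j a b, T i j = Some a -> T i j.+1 = Some b -> a < b;
  standard_col : forall i j a b, T i j = Some a -> T i.+1 j = Some b -> a < b
}.

Definition is_SYT_square (n : nat) (T : filling) : Prop :=
  standard (fun i j => (i < n) && (j < n)) (n ^ 2) T.

Definition slide_source (T : filling) (i j : nat) : option (nat * nat) :=
  match T i j.+1, T i.+1 j with
  | None, None => None
  | Some _, None => Some (i, j.+1)
  | None, Some _ => Some (i.+1, j)
  | Some a, Some b => Some (if a < b then (i, j.+1) else (i.+1, j))
  end.

(* Slides the empty box (i,j) outwards and returns the resulting filling along
   with the final position of the empty box.  Each step vacates a new filled
   box, so the number of filled boxes is always enough fuel. *)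
Fixpoint slide (fuel : nat) (T : filling) (i j : nat) : filling * (nat * nat) :=
  if fuel is f.+1 then
    if slide_source T i j is Some (k, l) then
      slide f (set_box (set_box T i j (T k l)) k l None) k l
    else (T, (i, j))
  else (T, (i, j)).

(* N is the number of boxes of T. *)
Definition promotion (N : nat) (T : filling) : filling :=
  let T1 := set_box (fun i j => omap predn (T i j)) 0 0 None in
  let: (T2, (i, j)) := slide N T1 0 0 in
  set_box T2 i j (Some N).

(* The empty cells (i,j), i <= j < n-1, are filled from the bottom row to the
   top one, and from right to left in each row; each of them is then an inner
   corner of the current skew shifted shape. *)
Definition haiman_inner_cells (n : nat) : seq (nat * nat) :=
  rev [seq (i, j) | i <- iota 0 n.-1, j <- iota i (n.-1 - i)].

Definition haiman_skew (n : nat) (T : filling) : filling :=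
  fun i j => if n.-1 <= j then T i (j - n.-1) else None.

Definition haiman (n : nat) (T : filling) : filling :=
  foldl (fun U c => (slide (n ^ 2) U c.1 c.2).1)
    (haiman_skew n T) (haiman_inner_cells n).

(* Insertion tableaux are sequences of rows; in the shifted case, row i starts
   in column i. *)
Definition tableau := seq (seq nat).

Fixpoint row_insert (P : tableau) (x : nat) : tableau :=
  if P is r :: P' then
    let k := find (fun y => x < y) r in
    if k < size r then set_nth 0 r k x :: row_insert P' (nth 0 r k)
    else rcons r x :: P'
  else [:: [:: x]].

Definition RSK_P (w : seq nat) : tableau := foldl row_insert [::] w.

(* Letters of the doubled alphabet 1' < 1 < 2' < 2 < ... are encoded in nat by
   a' |-> 2a - 1 and a |-> 2a: the order is that of nat, primed letters are the
   odd ones, priming is the predecessor, and 0 is free to denote an empty cell. *)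
Definition shifted_entry (P : tableau) (i j : nat) : nat :=
  if i <= j then nth 0 (nth [::] P i) (j - i) else 0.

Definition set_shifted_entry (P : tableau) (i j x : nat) : tableau :=
  set_nth [::] P i (set_nth 0 (nth [::] P i) (j - i) x).

(* Inserts the letter x into row k (if [isrow]) or into column k (otherwise),
   bumping the smallest entry strictly greater than x.  Successively inserted
   letters weakly increase, so no box is bumped twice and the number of boxes
   plus one is enough fuel. *)
Fixpoint mixed_bump (fuel : nat) (P : tableau) (isrow : bool) (k x : nat) :
    tableau :=
  if fuel is f.+1 then
    let line := if isrow then nth [::] P k
                else [seq shifted_entry P i k | i <- iota 0 k.+1] in
    let m := find (fun y => (y == 0) || (x < y)) line in
    let: (i, j) := if isrow then (k, k + m) else (m, k) in
    let y := shifted_entry P i j in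
    let P' := set_shifted_entry P i j x in
    if y == 0 then P'
    else if i == j then mixed_bump f P' false j.+1 y.-1
    else if odd y then mixed_bump f P' false j.+1 y
    else mixed_bump f P' true i.+1 y
  else P.

Definition mixed_insert (P : tableau) (x : nat) : tableau :=
  mixed_bump (sumn (shape P)).+1 P true 0 x.*2.

Definition mixed_P (w : seq nat) : tableau := foldl mixed_insert [::] w.

(* [box k i j] says that (i,j) is a box of the k-th insertion tableau; the
   recording tableau contains k in the box added at step k. *)
Definition recording (box : nat -> rel nat) (N : nat) : filling :=
  fun i j =>
    let k := find (fun k => box k i j) (iota 0 N.+1) in
    if k <= N then Some k else None.

Definition RSK_Q (w : seq nat) : filling :=
  recording (fun k i j => j < size (nth [::] (RSK_P (take k w)) i)) (size w).

Definition mixed_Q (w : seq nat) : filling :=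
  recording (fun k i j =>
    (i <= j) && (j - i < size (nth [::] (mixed_P (take k w)) i))) (size w).

(* Increasing list of the positions in w, shifted by pos, of the letters j
   left unpaired, when depth letters j+1 to the left of w are still to be
   paired. *)
Fixpoint unpaired (j pos depth : nat) (w : seq nat) : seq nat :=
  if w is x :: w' then
    if x == j.+1 then unpaired j pos.+1 depth.+1 w'
    else if x == j then
      if depth is d.+1 then unpaired j pos.+1 d w'
      else pos :: unpaired j pos.+1 0 w'
    else unpaired j pos.+1 depth w'
  else [::].

(* [None] when there is no unpaired j, i.e. when e_j is not defined on w. *)
Definition crystal_e (j : nat) (w : seq nat) : option (seq nat) :=
  if unpaired j 0 0 w is p :: ps then Some (set_nth 0 w (last p ps) j.+1)
  else None.

Definition crystal_ebar (n : nat) (w : seq nat) : option (seq nat) :=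
  foldr (fun j u => obind (crystal_e j) u) (Some w) (iota 1 n.-1).

Definition square_word (n : nat) (w : seq nat) : Prop :=
  [/\ size w = n ^ 2,
      all (fun x => 1 <= x <= n) w,
      forall j, 1 <= j <= n -> count_mem j w = n
    & forall i j, 1 <= j < n ->
        count_mem j (take i w) <= count_mem j.+1 (take i w)].

(* Main.v *)
Require Import Defs.
From Stdlib Require Import FunctionalExtensionality.
From mathcomp Require Import all_boot zify.

(* A standard shifted tableau is determined by the word of the contents j - i of
   its boxes, listed in the order of their labels.  In terms of this word, a
   slide carries a content through the word ([push]): it is exchanged for the
   adjacent contents that it meets.  Rectification pushes the contents of the
   skew tableau through the word U of the empty cells, and promotion pushes the
   first content through the rest ([jdt]).  Both are pushes through a word, and
   rectification depends on that word only up to elementary dual equivalences of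
   four consecutive contents.  The staircase followed by n-1 is dual equivalent
   to the row 0 .. n-1 followed by a smaller staircase, that is, to the result of
   pushing n-1 through the staircase; this is why promotion commutes with
   Haiman's map.

   Let w be a square word and let g a i be the number of letters <= a in row i of
   its mixed insertion tableau.  Inserting x adds one box to each level a >= x,
   in row 0 for a = x, and the row for a + 1 is that for a or the next one
   ([hrow]).  Pushing the content of the corresponding box of Q(w) through the
   staircase follows the same rows, so that Q'(w) = H(Q(w)).

   Finally, the sliding path of p on Q(w) descends to the next row exactly at the
   letters changed by the crystal operators, e_j changing the letter at which the
   path leaves the row of j+1 for that of j. *)

Set Implicit Arguments.
Unset Strict Implicit.
Unset Printing Implicit Defensive.

(** * Slides on content words *)

(** Dual equivalence controls the letters that come out of a rectification, but not the cells that
    are left over. Comparing promotion before and after rectification therefore leaves the last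
    letter, the cell that receives the largest label, undetermined. It is recovered by counting:
    both results fill the doubled staircase, so they have the same multiset of contents. That the
    shape is this one is a fact about levels ([levels_final]), not about slides.

    The obstacle in the study of levels is a level that has to grow in a row where the next level is
    still empty, since the rule for the next row then breaks down. Interlacing does not exclude
    this, so the lattice condition is carried along as an inequality between partial sums of row
    lengths. *)

Definition incr (m : nat -> nat) (c : nat) : nat -> nat := fun x => m x + (x == c).

Definition near (x y : nat) : bool := (x == y.+1) || (y == x.+1).

(* m c is the number of boxes of content c that are already filled; the next box
   of content c is (m c, m c + c). *)
Fixpoint valid (m : nat -> nat) (w : seq nat) : bool :=
  if w is c :: w' then
    [&& m c == m c.+1, (c == 0) || (m c.-1 == (m c).+1) & valid (incr m c) w']
  else true.

(* The empty cells U are slid into from the last to the first; the letter that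
   comes out on the left is the new content of the box that had content b. *)
Fixpoint push (U : seq nat) (b : nat) : nat * seq nat :=
  if U is u :: U' then
    let: (c, V) := push U' b in if near u c then (u, c :: V) else (c, u :: V)
  else (b, [::]).

Fixpoint rect (U s : seq nat) : seq nat :=
  if s is b :: s' then (push U b).1 :: rect (push U b).2 s' else [::].

Fixpoint residue (U s : seq nat) : seq nat :=
  if s is b :: s' then residue (push U b).2 s' else U.

Definition addw (m : nat -> nat) (w : seq nat) : nat -> nat :=
  fun x => m x + count_mem x w.

Lemma eq_valid m m' w : m =1 m' -> valid m w = valid m' w.
Proof.
elim: w m m' => [//|c w IH] m m' e /=; rewrite !e (IH _ (incr m' c)) //.
by move=> x; rewrite /incr e.
Qed.

Lemma valid_cat m w1 w2 :
  valid m (w1 ++ w2) = valid m w1 && valid (addw m w1) w2.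
Proof.
elim: w1 m => [|c w1 IH] m /=.
  by apply: eq_valid => x; rewrite /addw addn0.
rewrite IH -!andbA; do 3!congr (_ && _); apply: eq_valid => x.
by rewrite /addw /incr /= (eq_sym c) addnA.
Qed.

(** A box of content [c] destroys the equalities that [c] needs, and only new boxes of contents
    [c.+1] and [c.-1] restore them. *)
Lemma valid_repeat m c s t : valid m (c :: s ++ c :: t) ->
  (c.+1 \in s) && ((c == 0) || (c.-1 \in s)).
Proof.
move=> /= /and3P[/eqP h1 h2]; rewrite valid_cat => /andP[_] /= /and3P[h3 h4 _].
move: h3 h4; rewrite /addw /incr -!has_pred1 !has_count.
by case: c h1 h2 => [|c] /=; lia.
Qed.

Lemma valid_swap m x y s : ~~ near x y ->
  valid m (x :: y :: s) -> valid m (y :: x :: s).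
Proof.
move=> nxy; have [->//|neq] := eqVneq x y.
rewrite /= => /and5P[h1 h2 h3 h4 h5].
have <- : valid (incr (incr m x) y) s = valid (incr (incr m y) x) s.
  by apply: eq_valid => z; rewrite /incr addnAC.
rewrite h5 andbT; move: nxy neq h1 h2 h3 h4; clear h5; rewrite /near /incr.
by case: x => [|x]; case: y => [|y] /=; lia.
Qed.

Lemma push_perm U b : perm_eq (rcons U b) ((push U b).1 :: (push U b).2).
Proof.
elim: U => [//|u U IH] /=; move: IH; case: (push U b) => c V /= IH.
case: ifP => _ /=.
  by rewrite perm_cons.
have /perm_trans : perm_eq (u :: rcons U b) (u :: c :: V) by rewrite perm_cons.
by apply; apply/permP => p /=; lia.
Qed.

(** Meeting an adjacent letter leaves the word as it is and only changes which letter is on the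
    move; all other letters commute with it. *)
Lemma push_valid m U b s : valid m (U ++ b :: s) ->
  valid m ((push U b).1 :: (push U b).2 ++ s).
Proof.
elim: U m => [//|u U IH] m /= /and3P[h1 h2 /IH].
case: (push U b) => c V /= h3; case: ifP => nuc /=.
  by rewrite h1 h2.
by apply: valid_swap; rewrite ?nuc //=; rewrite h1 h2.
Qed.

Lemma push_cat U1 U2 b : push (U1 ++ U2) b =
  ((push U1 (push U2 b).1).1, (push U1 (push U2 b).1).2 ++ (push U2 b).2).
Proof.
elim: U1 => [|u U1 IH] /=; first by case: push.
rewrite IH; case: (push U1 _) => c V /=; by case: ifP.
Qed.

Lemma rect_catl U1 U2 s : rect (U1 ++ U2) s = rect U1 (rect U2 s).
Proof. by elim: s U1 U2 => [//|b s IH] U1 U2 /=; rewrite push_cat IH. Qed.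

Lemma rect_catr U s1 s2 : rect U (s1 ++ s2) = rect U s1 ++ rect (residue U s1) s2.
Proof. by elim: s1 U => [//|b s1 IH] U /=; rewrite IH. Qed.

Lemma size_rect U s : size (rect U s) = size s.
Proof. by elim: s U => [//|b s IH] U /=; rewrite IH. Qed.

Lemma rect_valid m U s : valid m (U ++ s) -> valid m (rect U s ++ residue U s).
Proof.
elim: s U m => [|b s IH] U m /=; first by rewrite cats0.
by move/push_valid => /= /and3P[-> -> /IH].
Qed.

Lemma rect_perm U s : perm_eq (U ++ s) (rect U s ++ residue U s).
Proof.
elim: s U => [|b s IH] U /=; first by rewrite cats0.
have /perm_trans : perm_eq (U ++ b :: s) ((push U b).1 :: (push U b).2 ++ s).
  by rewrite -cat_rcons -cat_cons perm_cat2r push_perm.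
by apply; rewrite perm_cons.
Qed.

(** The final letter is the content of the vacated cell, which promotion fills with the largest
    label; the result is thus again the word of a whole tableau. *)
Fixpoint jdt (x : nat) (s : seq nat) : seq nat :=
  if s is b :: s' then if near x b then x :: jdt b s' else b :: jdt x s'
  else [:: x].

Lemma jdtE x s : jdt x s = rect [:: x] s ++ residue [:: x] s.
Proof. by elim: s x => [//|b s IH] x /=; rewrite !IH; case: ifP. Qed.

(** * Dual equivalence *)

(* Chosen so as to be closed under pushing a letter ([elem_push]) and to contain
   the exchanges needed for the staircase ([dual_row2]). *)
Definition elem (Y Y' : seq nat) : bool :=
  if (Y, Y') is ([:: a; b; c; d], [:: a'; b'; c'; d']) then
    [|| [&& (a, b, c, d) == (a', b', d', c'), a < b, c < b & b < d],
        [&& (a, b, c, d) == (b', a', c', d'), a < c, c < b & d < c]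
      | [&& (a, b, c, d) == (a', c', b', d'), a < b, c.+1 < b, d < b &
            ~~ ((a < c) && (d < c))]]
  else false.
Arguments elem : simpl never.

Lemma elem4 a b c d a' b' c' d' : elem [:: a; b; c; d] [:: a'; b'; c'; d'] =
    [|| [&& a == a', b == b', c == d', d == c', a < b, c < b & b < d],
        [&& a == b', b == a', c == c', d == d', a < c, c < b & d < c]
      | [&& a == a', b == c', c == b', d == d', a < b, c.+1 < b, d < b &
            ~~ ((a < c) && (d < c))]].
Proof. by rewrite /elem !xpair_eqE -!andbA. Qed.

Lemma elem_shape Y Y' : elem Y Y' -> exists a b c d,
  Y = [:: a; b; c; d] /\ [\/ [/\ Y' = [:: a; b; d; c], a < b, c < b & b < d],
        [/\ Y' = [:: b; a; c; d], a < c, c < b & d < c]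
      | [/\ Y' = [:: a; c; b; d], a < b, c.+1 < b, d < b &
            ~~ ((a < c) && (d < c))]].
Proof.
case: Y => [|a [|b [|c [|d []]]]] //; case: Y' => [|a' [|b' [|c' [|d' []]]]] //.
rewrite elem4 => h; exists a, b, c, d; split=> //.
case/or3P: h => /and4P[/eqP-> /eqP-> /eqP-> /and4P[]].
- by move=> /eqP-> ? ? ?; apply: Or31.
- by move=> /eqP-> ? ? ?; apply: Or32.
- by move=> /eqP-> ? ? /andP[? ?]; apply: Or33.
Qed.

Lemma nearC x y : near x y = near y x.
Proof. by rewrite /near orbC. Qed.

(* Consecutive occurrences of c in a valid word are separated by a c.+1 and, if
   c > 0, by a c.-1; unlike validity, this does not refer to the starting shape. *)
Fixpoint fc_scan (c : nat) (up down : bool) (w : seq nat) : bool :=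
  if w is d :: w' then
    if d == c then up && ((c == 0) || down)
    else fc_scan c (up || (d == c.+1)) (down || (c == d.+1)) w'
  else true.

Fixpoint fc (w : seq nat) : bool :=
  if w is c :: w' then fc_scan c false false w' && fc w' else true.

Lemma valid_fc m w : valid m w -> fc w.
Proof.
elim: w m => [//|c w IH] m v /=; apply/andP; split; last by case/and3P: v => _ _ /IH.
have H w1 w2 : w = w1 ++ w2 ->
    fc_scan c (c.+1 \in w1) ((c != 0) && (c.-1 \in w1)) w2.
  elim: w2 w1 => [//|d w2 IH2] w1 e /=; case: eqP => [E|_].
    have := @valid_repeat m c w1 w2; rewrite -{2}E -e => /(_ v) /andP[-> h].
    by move: h; case: (c == 0).
  have := IH2 (rcons w1 d); rewrite cat_rcons !mem_rcons !inE => /(_ e).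
  rewrite orbC (eq_sym _ d) andb_orr orbC [X in fc_scan _ _ X](_ : _ = (c != 0) && (c.-1 \in w1) || (c == d.+1)) //.
  by case: (c) => [|c'] //=; rewrite eqSS orbC.
by have := H [::] w erefl; rewrite !in_nil andbF.
Qed.

(** * Reduction of a property of five letters to a finite check *)

Definition similar (f : nat -> nat) (w : seq nat) : Prop :=
  forall u v, u \in w -> v \in w ->
  [/\ (f u < f v) = (u < v), (f u == (f v).+1) = (u == v.+1) & (f u == 0) = (u == 0)].

Section Similar.
Variables (f : nat -> nat).

Lemma similar_eq w u v : similar f w -> u \in w -> v \in w -> (f u == f v) = (u == v).
Proof.
move=> h uw vw; have [h1 _ _] := h _ _ uw vw; have [h2 _ _] := h _ _ vw uw.
by rewrite !eqn_leq (leqNgt (f u)) (leqNgt (f v)) (leqNgt u) (leqNgt v) h1 h2.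
Qed.

Lemma similar_near w u v : similar f w -> u \in w -> v \in w ->
  near (f u) (f v) = near u v.
Proof.
move=> h uw vw; have [_ h1 _] := h _ _ uw vw; have [_ h2 _] := h _ _ vw uw.
by rewrite /near h1 h2.
Qed.

Lemma similar_sub w w' : {subset w' <= w} -> similar f w -> similar f w'.
Proof. by move=> s h u v /s uw /s vw; apply: h. Qed.

Lemma similar_fc w : similar f w -> fc (map f w) = fc w.
Proof.
elim: w => [//|c w IH] h /=.
rewrite IH; last by apply: similar_sub h => x; rewrite inE orbC => ->.
congr (_ && _).
suff H b1 b2 : fc_scan (f c) b1 b2 (map f w) = fc_scan c b1 b2 w by apply: H.
elim: w b1 b2 h {IH} => [//|d w IH2] b1 b2 h /=.
have [cw dw] : c \in [:: c, d & w] /\ d \in [:: c, d & w].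
  by rewrite !inE !eqxx orbT.
rewrite (similar_eq h) //; have [_ -> _] := h _ _ dw cw.
have [_ -> ->] := h _ _ cw dw; case: ifP => // _.
have h' : similar f (c :: w).
  by apply: similar_sub h => x; rewrite !inE => /orP[->|->]; rewrite ?orbT.
exact: IH2.
Qed.

Lemma similar_push U b : similar f (rcons U b) ->
  push (map f U) (f b) = (f (push U b).1, map f (push U b).2).
Proof.
elim: U => [//|u U IH] h /=; rewrite IH; last first.
  by apply: similar_sub h => x; rewrite inE orbC => ->.
have := push_perm U b; case: (push U b) => c V /= p.
rewrite (similar_near h) ?inE ?eqxx //; first by case: ifP.
by rewrite (perm_mem p) inE eqxx orbT.
Qed.

Lemma similar_elem Y Y' : similar f (Y ++ Y') ->
  elem (map f Y) (map f Y') = elem Y Y'.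
Proof.
case: Y => [|a [|b [|c [|d []]]]] //; case: Y' => [|a' [|b' [|c' [|d' []]]]] // h.
have lt u v : u \in [:: a; b; c; d; a'; b'; c'; d'] ->
   v \in [:: a; b; c; d; a'; b'; c'; d'] -> (f u < f v) = (u < v).
  by move=> hu hv; have [] := h _ _ hu hv.
have S u v : u \in [:: a; b; c; d; a'; b'; c'; d'] ->
   v \in [:: a; b; c; d; a'; b'; c'; d'] -> ((f u).+1 < f v) = (u.+1 < v).
  move=> hu hv; have [_ h1 _] := h _ _ hv hu.
  by rewrite !(ltn_neqAle _.+1) lt // !(eq_sym _.+1) h1.
by rewrite /= !elem4 !(similar_eq h) ?lt ?S ?inE ?eqxx ?orbT.
Qed.

End Similar.

(** The three candidates exhaust the right-hand sides of [elem] on a given word, which makes the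
    closure under pushing computable. *)
Definition elem_push_ok (w : seq nat) : bool :=
  if w is [:: x; y; z; t; b] then
    let Y := [:: x; y; z; t] in
    fc w ==> all (fun Y' => elem Y Y' ==> ((push Y b).1 == (push Y' b).1) &&
      (elem (push Y b).2 (push Y' b).2 || elem (push Y' b).2 (push Y b).2))
      [:: [:: x; y; t; z]; [:: y; x; z; t]; [:: x; z; y; t]]
  else true.

Lemma similar_elem_push_ok f w : similar f w ->
  elem_push_ok (map f w) = elem_push_ok w.
Proof.
case: w => [|x [|y [|z [|t [|b []]]]]] // h.
rewrite /elem_push_ok -(similar_fc h) [map _ _]/=; congr (_ ==> _).
have ok u v (Y Y' : seq nat) : {subset rcons Y u <= [:: x; y; z; t; b]} ->
    {subset rcons Y' v <= [:: x; y; z; t; b]} ->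
   (elem (map f Y) (map f Y') ==>
     ((push (map f Y) (f u)).1 == (push (map f Y') (f v)).1) &&
     (elem (push (map f Y) (f u)).2 (push (map f Y') (f v)).2
   || elem (push (map f Y') (f v)).2 (push (map f Y) (f u)).2)) =
   (elem Y Y' ==>
     ((push Y u).1 == (push Y' v).1) &&
     (elem (push Y u).2 (push Y' v).2 || elem (push Y' v).2 (push Y u).2)).
  move=> sY sY'; have hY := similar_sub sY h; have hY' := similar_sub sY' h.
  rewrite !similar_push //=.
  have s1 : {subset (push Y u).1 :: (push Y u).2 <= [:: x; y; z; t; b]}.
    by move=> k; rewrite -(perm_mem (push_perm Y u)); apply: sY.
  have s2 : {subset (push Y' v).1 :: (push Y' v).2 <= [:: x; y; z; t; b]}.
    by move=> k; rewrite -(perm_mem (push_perm Y' v)); apply: sY'.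
  rewrite (similar_eq h); [|exact/s1/mem_head|exact/s2/mem_head].
  rewrite !similar_elem //; apply: similar_sub h => k; rewrite mem_cat => /orP[] hk.
  - by apply: s2; rewrite inE hk orbT.
  - by apply: s1; rewrite inE hk orbT.
  - by apply: s1; rewrite inE hk orbT.
  - by apply: s2; rewrite inE hk orbT.
  - by apply: sY; rewrite mem_rcons inE hk orbT.
  - by apply: sY'; rewrite mem_rcons inE hk orbT.
have s0 : {subset [:: x; y; z; t; b] <= [:: x; y; z; t; b]} by [].
have p Y' : perm_eq Y' [:: x; y; z; t] -> {subset rcons Y' b <= [:: x; y; z; t; b]}.
  move=> p k; rewrite mem_rcons inE (perm_mem p) => /orP[/eqP->|].
    by rewrite !inE eqxx !orbT.
  by rewrite !inE => /or4P[] ->; rewrite ?orbT.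
rewrite /= -!(ok b b) //; apply: p; apply/permP => q /=; lia.
Qed.

(* Closes a gap {v, v+1}: five letters that are not all below 10 leave such a gap,
   so only boundedly many words have to be checked. *)
Definition contract (v x : nat) : nat := if v < x then x.-1 else x.

(** A gap of two values is needed: after the contraction its two sides still differ by at least 2,
    so no adjacency is created, and for [v = 0] no letter becomes 0. *)
Lemma contract_similar v w : v \notin w -> v.+1 \notin w -> similar (contract v) w.
Proof.
move=> vw v1w x y xw yw.
have [nx ny] : x != v /\ y != v by split; apply: contraNneq vw => <-.
have [nx1 ny1] : x != v.+1 /\ y != v.+1 by split; apply: contraNneq v1w => <-.
rewrite /contract; case: (ltnP v x) => hx; case: (ltnP v y) => hy; split; lia.
Qed.

(** Pigeonhole on the [k] pairs {2j, 2j+1}: the large letter lies in none of them, and the fewer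
    than [k] others cannot meet them all. *)
Lemma gap_exists (w : seq nat) k : has (leq k.*2) w -> size w <= k ->
  exists2 j, j < k & (j.*2 \notin w) && (j.*2.+1 \notin w).
Proof.
move=> big sz.
have [/hasP[j]|] := boolP (has (fun j => j \notin map half w) (iota 0 k)).
  rewrite mem_iota => /= jk nj; exists j => //; apply/andP; split.
    by apply: contra nj => jw; apply/mapP; exists j.*2; rewrite ?doubleK.
  by apply: contra nj => jw; apply/mapP; exists j.*2.+1; rewrite //= uphalf_double.
rewrite -all_predC => /allP sub; case/hasP: big => M Mw kM.
have : size (M./2 :: iota 0 k) <= size (map half w).
  apply: uniq_leq_size.
    rewrite /= iota_uniq mem_iota andbT add0n -leqNgt -(doubleK k).
    exact: half_leq.
  move=> x; rewrite inE => /orP[/eqP->|/sub /=]; first exact: map_f.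
  by rewrite negbK.
by rewrite /= size_iota size_map ltnNge sz.
Qed.

Definition words5 (k : nat) (p : seq nat -> bool) : bool :=
  let r := iota 0 k in
  all (fun x => all (fun y => all (fun z => all (fun t => all (fun b =>
    p [:: x; y; z; t; b]) r) r) r) r) r.

Lemma elem_push_ok_bounded : words5 10 elem_push_ok.
Proof. by vm_compute. Qed.

(** Induction on the sum of the letters, which [contract] lowers as long as some letter is at least
    10, twice the number of letters. *)
Lemma elem_push_okT w : elem_push_ok w.
Proof.
have [n le_n] := ubnP (sumn w); elim: n w le_n => [//|n IH] w le_n.
have [sw|] := eqVneq (size w) 5; last first.
  by case: w {le_n} => [|x [|y [|z [|t [|b []]]]]].
have [big|small] := boolP (has (leq 10) w).
  have [j j5 /andP[h1 h2]] := @gap_exists w 5 big (eq_leq sw).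
  rewrite -(similar_elem_push_ok (contract_similar h1 h2)); apply: IH.
  apply: (leq_trans _ (le_n : sumn w <= n)).
  case/hasP: big => M Mw M10; elim: w Mw {sw h1 h2 le_n} => [//|x w IHw] /=.
  have le l : sumn (map (contract j.*2) l) <= sumn l.
    by elim: l => //= a l; rewrite /contract; case: ifP; lia.
  rewrite inE => /orP[/eqP<-|/IHw]; last by rewrite /contract; case: ifP; lia.
  by have := le w; rewrite /contract; case: ifP; lia.
move: sw small; case: w {le_n} => [|x [|y [|z [|t [|b []]]]]] // _.
rewrite -all_predC => /allP h; have := elem_push_ok_bounded.
have m k : k \in [:: x; y; z; t; b] -> k \in iota 0 10.
  by move/h; rewrite mem_iota /= -ltnNge.
have [mx my mz mt mb] : [/\ x \in iota 0 10, y \in iota 0 10, z \in iota 0 10,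
    t \in iota 0 10 & b \in iota 0 10].
  by split; apply: m; rewrite !inE eqxx ?orbT.
by move=> /allP/(_ x mx)/allP/(_ y my)/allP/(_ z mz)/allP/(_ t mt)/allP/(_ b mb).
Qed.

Definition elems Y Y' := elem Y Y' || elem Y' Y.

Lemma elem_push m Y Y' b : elem Y Y' -> valid m (rcons Y b) ->
  (push Y b).1 = (push Y' b).1 /\ elems (push Y b).2 (push Y' b).2.
Proof.
move=> e v; have [x [y [z [t [EY EY']]]]] := elem_shape e.
have := elem_push_okT [:: x; y; z; t; b].
rewrite /elem_push_ok (valid_fc (m := m)); last by rewrite EY in v.
have hY' : Y' \in [:: [:: x; y; t; z]; [:: y; x; z; t]; [:: x; z; y; t]].
  by case: EY' => -[-> *]; rewrite !inE eqxx ?orbT.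
by move=> /allP /(_ _ hY'); rewrite -EY e => /andP[/eqP-> ?]; split.
Qed.

(** Each move exchanges two letters that differ by at least 2. *)
Lemma elem_valid m Y Y' s : elem Y Y' -> valid m (Y ++ s) = valid m (Y' ++ s).
Proof.
have sw X x y t : ~~ near x y -> valid m (X ++ x :: y :: t) = valid m (X ++ y :: x :: t).
  rewrite !valid_cat => nxy; congr (_ && _); apply/idP/idP; apply: valid_swap => //.
  by rewrite nearC.
move/elem_shape => [a [b [c [d [-> []]]]]] [-> *].
- by apply: (sw [:: a; b]); rewrite /near; lia.
- by apply: (sw [::]); rewrite /near; lia.
- by apply: (sw [:: a]); rewrite /near; lia.
Qed.

Inductive dual : seq nat -> seq nat -> Prop :=
| Dual_refl U : dual U U
| Dual_elem X Y Y' Z : elems Y Y' -> dual (X ++ Y ++ Z) (X ++ Y' ++ Z)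
| Dual_trans U V W : dual U V -> dual V W -> dual U W.

Lemma dual_sym U V : dual U V -> dual V U.
Proof.
elim=> [W|X Y Y' Z h|W1 W2 W3 _ h1 _ h2]; first exact: Dual_refl.
  by apply: Dual_elem; rewrite /elems orbC.
exact: Dual_trans h1.
Qed.

Lemma dual_cat X U V Z : dual U V -> dual (X ++ U ++ Z) (X ++ V ++ Z).
Proof.
elim=> [W|X' Y Y' Z' h|W1 W2 W3 _ h1 _ h2]; first exact: Dual_refl.
  rewrite -!catA !(catA X); exact: Dual_elem.
exact: Dual_trans h1 h2.
Qed.

Lemma dual_valid m U V s : dual U V -> valid m (U ++ s) = valid m (V ++ s).
Proof.
move=> d; elim: d s => [//|X Y Y' Z h|W1 W2 W3 _ h1 _ h2] s; last by rewrite h1.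
rewrite -!catA !(valid_cat _ X); congr (_ && _).
by case/orP: h => /elem_valid ->.
Qed.

Lemma dual_push m U V b : dual U V -> valid m (rcons U b) ->
  (push U b).1 = (push V b).1 /\ dual (push U b).2 (push V b).2.
Proof.
elim=> {U V} [U|X Y Y' Z h|U V W d1 IH1 d2 IH2] v.
- by split=> //; apply: Dual_refl.
- rewrite !push_cat /=; set c := (push Z b).1.
  have vY Y1 : valid m (rcons (X ++ Y1 ++ Z) b) -> valid (addw m X) (rcons Y1 c).
    rewrite -!cats1 -catA valid_cat => /andP[_]; rewrite -catA valid_cat.
    move=> /andP[vY /push_valid]; rewrite cats0 => vZ.
    by rewrite valid_cat vY; case/and3P: vZ => h1 h2 _; rewrite /= h1 h2.
  have vX : valid m (rcons (X ++ Y' ++ Z) b).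
    move: v; rewrite -!cats1 -!catA !(valid_cat _ X) => /andP[->].
    by case/orP: h => /elem_valid->.
  have [e1 e2] : (push Y c).1 = (push Y' c).1 /\ elems (push Y c).2 (push Y' c).2.
    case/orP: h => h; first exact: elem_push h (vY _ v).
    have [-> ] := elem_push h (vY _ vX).
    by rewrite /elems orbC.
  by rewrite -e1; split=> //; apply: Dual_elem.
- have [-> h1] := IH1 v; have vV : valid m (rcons V b).
    by rewrite -cats1 -(dual_valid _ _ d1) cats1.
  have [-> h2] := IH2 vV; split=> //; exact: Dual_trans h1 h2.
Qed.

(** Both words let the same letter out and remain dual equivalent, so the next letter meets the same
    situation. *)
Lemma dual_rect m U V s : dual U V -> valid m (U ++ s) -> rect U s = rect V s.
Proof.
elim: s U V m => [//|b s IH] U V m d v /=.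
have v1 : valid m (rcons U b) by move: v; rewrite -cat_rcons valid_cat => /andP[].
have [-> d'] := dual_push d v1; congr cons.
by move/push_valid: v => /= /and3P[_ _]; apply: IH.
Qed.

(** To exchange [y] with the last letter of the short row, a letter of intermediate size must stand
    just before them, itself preceded by a smaller one. The last letter of the long row can play
    this part: the induction hypothesis, read backwards, carries it to the right, and read forwards
    it carries it back after the exchange. *)
Lemma dual_row2 a b y : b < a <= y ->
  dual (iota 0 a ++ iota 0 b ++ [:: y]) (iota 0 a ++ y :: iota 0 b).
Proof.
elim: b a y => [|b IH] a y /andP[ba ay]; first exact: Dual_refl.
case: a ba ay => [//|a] ba ay; rewrite ltnS in ba.
have Sr k : iota 0 k.+1 = iota 0 k ++ [:: k] by rewrite -addn1 iotaD.
have last_step x c : x < a -> c < a -> dual [:: x; a; c; y] [:: x; a; y; c].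
  move=> xa ca; apply: (@Dual_elem [::] [:: x; a; c; y] [:: x; a; y; c] [::]).
  by rewrite /elems elem4 !eqxx xa ca ay.
case: b IH ba => [|b] IH ba.
  case: a ba ay last_step {IH} => [//|a] ba ay last_step.
  rewrite !Sr -!catA.
  exact: (dual_cat (iota 0 a) [::] (last_step a 0 (leqnn _) isT)).
apply: (@Dual_trans _ (iota 0 a ++ iota 0 b.+1 ++ [:: a; b.+1; y])).
  rewrite Sr (Sr b.+1) -!catA; apply: dual_sym.
  have := @IH a a; rewrite ba leqnn => /(_ isT) d.
  have := dual_cat [::] [:: b.+1; y] d; by rewrite -!catA.
apply: (@Dual_trans _ (iota 0 a ++ iota 0 b.+1 ++ [:: a; y; b.+1])).
  rewrite (Sr b) -!catA !(catA (iota 0 a)).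
  by apply: (dual_cat _ [::] (last_step b b.+1 _ _)); lia.
apply: (@Dual_trans _ (iota 0 a.+1 ++ iota 0 b.+1 ++ [:: y; b.+1])).
  rewrite (Sr a) -!catA.
  have := @IH a a; rewrite ba leqnn => /(_ isT) d.
  have := dual_cat [::] [:: y; b.+1] d; by rewrite -!catA.
have := @IH a.+1 y; rewrite ay andbT ltnS (ltnW ba) => /(_ isT) d.
have := dual_cat [::] [:: b.+1] d; by rewrite (Sr b.+1) -!catA.
Qed.

(** * The staircase word and its exchange with promotion *)

Fixpoint stair (k : nat) : seq nat :=
  if k is j.+1 then iota 0 k ++ stair j else [::].

Lemma stairS k : stair k.+1 = iota 0 k.+1 ++ stair k.
Proof. by []. Qed.

Lemma dual_stair a k y : k < a <= y ->
  dual (iota 0 a ++ stair k ++ [:: y]) (iota 0 a ++ y :: stair k).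
Proof.
elim: k a => [|k IH] a /andP[ka ay]; first exact: Dual_refl.
apply: (@Dual_trans _ (iota 0 a ++ iota 0 k.+1 ++ y :: stair k)).
  have d : dual (iota 0 k.+1 ++ stair k ++ [:: y]) (iota 0 k.+1 ++ y :: stair k).
    by apply: IH; lia.
  have := dual_cat (iota 0 a) [::] d; by rewrite !cats0 -!catA.
have d : dual (iota 0 a ++ iota 0 k.+1 ++ [:: y]) (iota 0 a ++ y :: iota 0 k.+1).
  by apply: dual_row2; lia.
have := dual_cat [::] (stair k) d; by rewrite -!catA.
Qed.

Lemma push_far U c : all (fun u => ~~ near u c) U -> push U c = (c, U).
Proof. by elim: U => [//|u U IH] /= /andP[h /IH->]; rewrite (negbTE h). Qed.

Lemma push_iota s l : push (iota s l) (s + l) = (s, iota s.+1 l).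
Proof.
elim: l s => [|l IH] s /=; first by rewrite addn0.
by rewrite addnS -addSn IH /near eqxx orbT.
Qed.

Lemma stair_lt k : all (fun u => u < k) (stair k).
Proof.
elim: k => [//|k IH] /=; rewrite all_cat; apply/andP; split.
  by apply/allP => x; rewrite mem_iota; lia.
by apply: sub_all IH => x /=; lia.
Qed.

(** Only the first row of the staircase contains a letter adjacent to [k], and [k] runs through that
    row down to 0. *)
Lemma push_stair k : (push (stair k) k).1 :: (push (stair k) k).2 =
  iota 0 k.+1 ++ stair k.-1.
Proof.
case: k => [//|k]; rewrite stairS push_cat.
rewrite (@push_far (stair k)); last first.
  by apply: sub_all (stair_lt k) => x; rewrite /near; lia.
by have := push_iota 0 k.+1; rewrite add0n => ->.
Qed.

(** Both sides rectify [s] through a word of empty cells, [stair k ++ [:: k]] on one side and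
    [x :: U] on the other. These are dual equivalent, which settles all letters but the last; the
    last one follows from the permutation hypothesis. *)
Lemma rect_stair_jdt k s :
  valid (fun _ => 0) (stair k ++ k :: s) ->
  perm_eq (rect (stair k) (jdt k s)) (rect (stair k) (k :: s)) ->
  exists x t, rect (stair k) (k :: s) = x :: t /\
              rect (stair k) (jdt k s) = jdt x t.
Proof.
move=> v; rewrite /=; set x := (push _ _).1; set U := (push _ _).2 => p.
exists x, (rect U s); split=> //.
have E : rect (stair k) (rect [:: k] s) = rect [:: x] (rect U s).
  rewrite -!rect_catl [[:: x] ++ U]push_stair; apply: (dual_rect (m := fun _ => 0)).
    case: (k) => [|j]; first exact: Dual_refl.
    rewrite stairS -catA [j.+1.-1]/=.
    have d : dual (iota 0 j.+1 ++ stair j ++ [:: j.+1]) (iota 0 j.+1 ++ j.+1 :: stair j).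
      by apply: dual_stair; lia.
    apply: (Dual_trans d); rewrite -(addn1 j.+1) iotaD -catA.
    exact: Dual_refl.
  by rewrite -catA.
move: p; rewrite !jdtE rect_catr E.
have [y Ey] : exists y, rect (residue (stair k) (rect [:: k] s)) (residue [:: k] s) = [:: y].
  have : size (residue [:: k] s) = 1.
    by elim: (s) (k) => [//|b s' IH] k' /=; case: ifP => _ /=; apply: IH.
  by case: (residue [:: k] s) => [//|z []] //= _; eexists.
have [z Ez] : exists z, residue [:: x] (rect U s) = [:: z].
  elim: (rect U s) (x) => [|b s' IH] k' /=; first by exists k'.
  by case: ifP => _ /=; apply: IH.
rewrite Ey Ez => p; congr (_ ++ [:: _]).
have /perm_trans : perm_eq (x :: rect U s) (rect [:: x] (rect U s) ++ [:: z]).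
  by rewrite -Ez; apply: (rect_perm [:: x]).
move=> /(_ _)/(_ _); move: p => /perm_trans p h.
have : perm_eq (rect [:: x] (rect U s) ++ [:: y]) (rect [:: x] (rect U s) ++ [:: z]).
  by apply: p; rewrite -Ez; apply: (rect_perm [:: x]).
by rewrite perm_cat2l => /perm_mem/(_ y); rewrite !inE eqxx => /esym/eqP.
Qed.

(** * Levels of an insertion *)

(* The row in which level x + d grows when x is inserted. *)
Fixpoint hrow (g : nat -> nat -> nat) (x d : nat) : nat :=
  if d is e.+1 then
    let i := hrow g x e in if g (x + e).+1 i == (g (x + e) i).+1 then i else i.+1
  else 0.

Definition hop (g : nat -> nat -> nat) (x a i : nat) : nat :=
  g a i + ((x <= a) && (i == hrow g x (a - x))).

Definition psum (f : nat -> nat) (i : nat) : nat := \sum_(l < i) f l.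
Definition pcount (f : nat -> nat) (i : nat) : nat := \sum_(l < i) (0 < f l).

Lemma psumS f i : psum f i.+1 = psum f i + f i.
Proof. by rewrite /psum big_ord_recr. Qed.

Lemma pcountS f i : pcount f i.+1 = pcount f i + (0 < f i).
Proof. by rewrite /pcount big_ord_recr. Qed.

Lemma psum0 f : psum f 0 = 0. Proof. by rewrite /psum big_ord0. Qed.
Lemma pcount0 f : pcount f 0 = 0. Proof. by rewrite /pcount big_ord0. Qed.

Lemma psum_incr f p i : psum (incr f p) i = psum f i + (p < i).
Proof.
elim: i => [|i IH]; first by rewrite !psum0.
by rewrite !psumS IH /incr; lia.
Qed.

Lemma pcount_incr f p i :
  pcount (incr f p) i = pcount f i + ((p < i) && (f p == 0)).
Proof.
elim: i => [|i IH]; first by rewrite !pcount0.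
rewrite !pcountS IH /incr; have [<-|] := eqVneq i p; last by lia.
by case: (f i) => [|k]; lia.
Qed.

Lemma psum_const f i j : (forall l, i <= l -> f l = 0) -> i <= j -> psum f j = psum f i.
Proof.
move=> z; elim: j => [|j IH]; first by rewrite leqn0 => /eqP->.
rewrite leq_eqVlt => /orP[/eqP->//|]; rewrite ltnS psumS => ij.
by rewrite z // addn0 IH.
Qed.

Lemma psum_tail f i n : (forall l, i <= l -> f l = 0) ->
  (forall l, n <= l -> f l = 0) -> psum f n = psum f i.
Proof.
by move=> zi zn; rewrite -(psum_const zn (leq_maxl n i)) (psum_const zi (leq_maxr n i)).
Qed.

Lemma pcount_le f i : pcount f i <= i.
Proof.
elim: i => [|i IH]; first by rewrite pcount0.
by rewrite pcountS; case: (0 < f i); lia.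
Qed.

Lemma pcount_full f i : (forall l, l < i -> 0 < f l) -> pcount f i = i.
Proof.
elim: i => [|i IH] h; first by rewrite pcount0.
by rewrite pcountS h // IH ?addn1 // => l li; apply: h; apply: ltnW.
Qed.

Lemma pcount_mono f f' i : (forall l, 0 < f l -> 0 < f' l) -> pcount f i <= pcount f' i.
Proof.
by move=> h; apply: leq_sum => l _; have := h l; case: (0 < f l) => // ->.
Qed.

(** Rows are shifted, so the first bound forbids a 2 by 2 square among the boxes between the two
    levels. The second one says that a row that is nonempty at the first level contains the next
    letter. *)
Definition interlaced (f f' : nat -> nat) : Prop :=
  forall i, f' i.+1 <= f i /\ (0 < f i -> f i < f' i).

Definition can_hop (f : nat -> nat) (k : nat) : bool := (k == 0) || ((f k).+1 < f k.-1).

(** If row [k] has a single letter of the next level, the displaced copy returns to row [k]; if it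
    has at least two, the displaced copy takes the place of the second, which moves to row
    [k.+1]. *)
Definition linked (f f' : nat -> nat) (k k' : nat) : Prop :=
  (f' k = (f k).+1 /\ k' = k) \/ ((f k).+1 < f' k /\ k' = k.+1).

Lemma interlaced_mono f f' : interlaced f f' -> forall i j, i <= j -> f' j <= f' i.
Proof.
move=> h i j; elim: j => [|j IH]; first by rewrite leqn0 => /eqP->.
rewrite leq_eqVlt => /orP[/eqP->//|]; rewrite ltnS => /IH; apply: leq_trans.
by have [] := h j; case: (f j) => [|k]; lia.
Qed.

Lemma interlaced_incr f f' k k' : interlaced f f' -> can_hop f k ->
  linked f f' k k' -> interlaced (incr f k) (incr f' k').
Proof.
move=> h ck lk i; have [h1 h2] := h i; have [h3 h4] := h k; move: ck lk.
rewrite /can_hop /linked /incr.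
have [E|n1] := eqVneq i k; first by subst k; lia.
have [E|n2] := eqVneq i.+1 k; first by subst k; rewrite /=; lia.
by lia.
Qed.

Lemma can_hop_linked f f' k k' : interlaced f f' -> can_hop f k ->
  linked f f' k k' -> can_hop f' k'.
Proof.
move=> h ck lk; have [h3 h4] := h k; move: ck lk; rewrite /can_hop /linked.
case: k h3 h4 => [|k] h3 h4 /= ck [[E ->]|[E ->]] /=; try lia.
by have := h k; lia.
Qed.

Lemma hop_linked f f' k : interlaced f f' -> (f k == 0 -> 0 < f' k) ->
  linked f f' k (if f' k == (f k).+1 then k else k.+1).
Proof.
move=> /(_ k) [_ h] b; case: eqP => [|n]; [by left|right; split=> //].
by case: (f k) h b n => [|i] h b n; lia.
Qed.

(* The trace of the lattice condition on three consecutive levels.  It is not a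
   consequence of interlacing, and ensures that a level never grows in an empty
   row of the next one ([lattice_birth]). *)
Definition lattice_ineq (cf cf' : nat) (e f f' : nat -> nat) (i : nat) : Prop :=
  cf + psum f' i.+1 + psum e i + pcount e i <=
  cf' + psum f i + psum f i.+1 + pcount f i.+1.

(** Subtracted from the totals, [lattice_ineq] bounds the middle letters in rows [k] and below by
    the last letters strictly below row [k], plus [pcount f k.+1 - pcount e k]. If row [k.+1] of
    [f'] were empty, this bound would be at most 0 + (k+1) - k = 1, whereas row [k] contains at
    least two middle letters. *)
Lemma lattice_birth n cf cf' e f f' k :
  interlaced e f -> interlaced f f' ->
  (forall i j, i <= j -> e j <= e i) ->
  (forall l, n <= l -> f' l = 0) ->
  psum f n = psum e n + cf -> psum f' n = psum f n + cf' ->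
  lattice_ineq cf cf' e f f' k ->
  can_hop e k -> (e k).+1 < f k -> f k.+1 = 0 -> 0 < f' k.+1.
Proof.
move=> h1 h2 em z s1 s2 F ce ef fz; rewrite lt0n; apply/negP => /eqP f'z.
have zf l : k < l -> f l = 0.
  by move=> kl; have := interlaced_mono h1 kl; rewrite fz leqn0 => /eqP.
have zf' l : k < l -> f' l = 0.
  by move=> kl; have := interlaced_mono h2 kl; rewrite f'z leqn0 => /eqP.
have up l : f l = 0 -> e l = 0 by have := (h1 l).2; lia.
have up' l : f' l = 0 -> f l = 0 by have := (h2 l).2; lia.
have E1 := @psum_tail f k.+1 n zf (fun l h => up' l (z l h)).
have E2 := @psum_tail f' k.+1 n zf' z.
have E3 := @psum_tail e k.+1 n (fun l h => up l (zf l h)) (fun l h => up l (up' l (z l h))).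
have N1 : pcount e k = k.
  apply: pcount_full => l lk; move: ce; rewrite /can_hop; case: k lk {F ef fz f'z zf zf' E1 E2 E3} => //= k lk.
  by have := em l k; lia.
have N2 := pcount_le f k.+1.
by move: F; rewrite /lattice_ineq; move: E1 E2 E3; rewrite !psumS; lia.
Qed.

Lemma lattice_incr n cf cf' e f f' k p q i :
  interlaced e f -> interlaced f f' ->
  (forall i j, i <= j -> e j <= e i) ->
  (forall l, n <= l -> f' l = 0) ->
  psum f n = psum e n + cf -> psum f' n = psum f n + cf' ->
  (forall j, (j == 0) || (0 < e j.-1) -> lattice_ineq cf cf' e f f' j) ->
  can_hop e k -> linked e f k p -> linked f f' p q ->
  (i == 0) || (0 < incr e k i.-1) ->
  lattice_ineq cf cf' (incr e k) (incr f p) (incr f' q) i.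
Proof.
move=> h1 h2 em z s1 s2 F ce l1 l2 ok.
rewrite /lattice_ineq !psum_incr !pcount_incr.
(* If the inequality for [i] was not yet required, then row [k = i.-1] of [e] has just become
   nonempty. The levels are empty below it, up to one row, and the inequality is computed from the
   totals. *)
have [okO|] := boolP ((i == 0) || (0 < e i.-1)); last first.
  rewrite negb_or -leqn0 leqNgt -ltnNge => /andP[ni ei].
  have [Ei ek] : i = k.+1 /\ e k = 0.
    by case: (i) ok ni ei => // j; rewrite /incr /=; case: eqVneq => [->|]; lia.
  have zf l : k < l -> f l = 0.
    by case: l => // l kl; have := (h1 l).1; have := em k l; lia.
  have zf' l : k.+1 < l -> f' l = 0.
    by case: l => // l kl; have := (h2 l).1; have := zf l; lia.
  have up l : f l = 0 -> e l = 0 by have := (h1 l).2; lia.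
  have up' l : f' l = 0 -> f l = 0 by have := (h2 l).2; lia.
  have E1 := @psum_tail f k.+1 n zf (fun l h => up' l (z l h)).
  have E2 := @psum_tail f' k.+2 n zf' z.
  have ze l : k <= l -> e l = 0 by have := em k l; lia.
  have E3 := @psum_tail e k n ze (fun l h => up l (up' l (z l h))).
  have N : pcount e k <= pcount f k by apply: pcount_mono => l; have := (h1 l).2; lia.
  move: E1 E2 E3 N (zf k.+1); rewrite Ei !psumS !pcountS ek.
  by case: l1 => -[l1 ?]; subst p; case: l2 => -[l2 ?]; subst q; lia.
have := F i okO; rewrite /lattice_ineq => Fi.
have mono_k : k < i -> 0 < e k.
  by case: (i) okO => //= j ej kj; have := em k j; lia.
case: l1 => -[l1 ?]; subst p; case: l2 => -[l2 ?]; subst q; try lia.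
(* The only tight case is [i = k.+1] with both hops in row [k.+1]. There the inequality is strict
   beforehand: compared with the one for row [k], it gains the letters [f k - e k] and loses the
   single letter [f' k.+1 - f k.+1]. *)
have [E|ne] := eqVneq i k.+1; last by lia.
have : (k == 0) || (0 < e k.-1).
  by case: (k) mono_k E => // j h E /=; have := em j j.+1; lia.
move/F; rewrite /lattice_ineq; move: Fi; rewrite E !psumS !pcountS; lia.
Qed.

(** The invariant of the insertion of a prefix with letter counts [c]. The last field bounds row 0
    by the end of the run of empty cells through which a new letter enters (the parameter [M] of
    [vrow]). *)
Record levels (n : nat) (g : nat -> nat -> nat) (c : nat -> nat) : Prop := Levels {
  levels0 : forall i, g 0 i = 0;
  levelsI : forall a, a < n -> interlaced (g a) (g a.+1);
  levelsC : forall a, a < n -> psum (g a.+1) n = psum (g a) n + c a.+1;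
  levelsF : forall a i, a.+1 < n -> (i == 0) || (0 < g a i.-1) ->
    lattice_ineq (c a.+1) (c a.+2) (g a) (g a.+1) (g a.+2) i;
  levelsL : forall a, 0 < a < n -> c a <= c a.+1;
  levelsM : forall a, a < n -> g a.+1 0 <= a + c a.+1
}.

Section Levels.
Variables (n : nat) (g : nat -> nat -> nat) (c : nat -> nat).
Hypothesis G : levels n g c.

Lemma levels_rows a i : a <= n -> a <= i -> g a i = 0.
Proof.
elim: a i => [|a IH] i an ai; first exact: (levels0 G).
case: i ai => // i ai; apply/eqP; rewrite -leqn0 -(IH i) //; last exact: ltnW.
by have [] := levelsI G an i.
Qed.

Lemma levels_mono a i j : a <= n -> i <= j -> g a j <= g a i.
Proof.
case: a => [|a] an ij; first by rewrite !(levels0 G).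
exact: interlaced_mono (levelsI G an) _ _ ij.
Qed.

Variables (x : nat).
Hypothesis x_pos : 0 < x.
Hypothesis lat : forall a, 0 < a < n -> incr c x a <= incr c x a.+1.

Lemma hop_below a : a < x -> hop g x a = g a.
Proof.
by move=> ax; apply: functional_extensionality => i; rewrite /hop leqNgt ax addn0.
Qed.

Lemma hop_above d : hop g x (x + d) = incr (g (x + d)) (hrow g x d).
Proof.
by apply: functional_extensionality => i; rewrite /hop leq_addr addKn.
Qed.

(** The two claims support each other: the rule for the next row is sound only if the next level is
    nonempty in the current row. When the row changes this is [lattice_birth]; at the start it holds
    because [x.+1] must already be more frequent than [x]. *)
Lemma hrow_can_hop d : x + d <= n -> can_hop (g (x + d)) (hrow g x d) /\
  (x + d < n -> g (x + d) (hrow g x d) == 0 -> 0 < g (x + d).+1 (hrow g x d)).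
Proof.
elim: d => [|d IH] xn.
  split=> // {}xn _; rewrite addn0 /= in xn *.
  rewrite lt0n; apply: contraTN (lat (a := x) _); last by rewrite x_pos.
  move/eqP=> z; rewrite -ltnNge /incr eqxx gtn_eqF // addn0.
  have s := levelsC G xn.
  have z' : psum (g x.+1) n = 0.
    rewrite (@psum_const _ 0) ?psum0 // => l _.
    by apply/eqP; rewrite -leqn0 -z; apply: levels_mono.
  by lia.
rewrite addnS in xn *; have [h1 h2] := IH (ltnW xn).
have Ib := levelsI G xn; have lk := hop_linked Ib (h2 xn).
split; first exact: (can_hop_linked Ib h1 lk).
move=> xn2; case: lk => -[l1 /= ->]; first by rewrite l1.
move/eqP => z; apply: (lattice_birth (n := n) (k := hrow g x d) Ib (levelsI G xn2)).
- by move=> i j; apply: levels_mono; apply: ltnW.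
- by move=> l nl; apply: levels_rows => //; apply: leq_trans nl.
- exact: (levelsC G).
- exact: (levelsC G).
- apply: (levelsF G) => //; move: h1; rewrite /can_hop; case: (_ == 0) => //=.
  by apply: leq_ltn_trans.
- exact: h1.
- exact: l1.
- exact: z.
Qed.

Lemma hrow_linked d : x + d < n ->
  linked (g (x + d)) (g (x + d).+1) (hrow g x d) (hrow g x d.+1).
Proof.
move=> xn; have [_ /(_ xn)] := hrow_can_hop (ltnW xn).
exact: hop_linked (levelsI G xn).
Qed.

Lemma hop_top : hop g x x = incr (g x) 0.
Proof. by rewrite -{2 3}[x]addn0 hop_above. Qed.

Lemma hop_interlaced a : x <= n -> a < n -> interlaced (hop g x a) (hop g x a.+1).
Proof.
move=> xn an; case: (ltngtP a.+1 x) => ax.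
- by rewrite !hop_below //; [apply: (levelsI G) | apply: ltnW].
- have [d Ed] : exists d, a = x + d by exists (a - x); rewrite subnKC.
  rewrite Ed in an *; rewrite -addnS !hop_above addnS.
  have [h1 _] := hrow_can_hop (ltnW an).
  exact: interlaced_incr (levelsI G an) h1 (hrow_linked an).
- rewrite ax hop_top hop_below -?ax // => i.
  have := levelsI G an i; rewrite /incr; case: (i) => [|j]; lia.
Qed.

Lemma hop_psum a k : psum (hop g x a) k = psum (g a) k + ((x <= a) && (hrow g x (a - x) < k)).
Proof.
case: (leqP x a) => xa; last by rewrite hop_below // addn0.
by rewrite -(subnKC xa) hop_above psum_incr addKn.
Qed.

Lemma hrow_bound a : x <= a <= n -> hrow g x (a - x) < a.
Proof.
move=> /andP[xa an]; have [d Ed] : exists d, a = x + d by exists (a - x); rewrite subnKC.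
rewrite Ed addKn in an *; elim: d an {Ed} => [|d IH] an; first by rewrite addn0.
have xn : x + d < n by rewrite -addnS.
by have := IH (ltnW xn); case: (hrow_linked xn) => -[_ ->]; rewrite addnS; lia.
Qed.

Lemma levels_hop : x <= n -> levels n (hop g x) (incr c x).
Proof.
move=> xn; split.
- by move=> i; rewrite hop_below // (levels0 G).
- by move=> a; apply: hop_interlaced.
- move=> a an; rewrite !hop_psum (levelsC G) // /incr.
  have := @hrow_bound a; have := @hrow_bound a.+1.
  by case: (ltngtP a.+1 x) => ax; lia.
- move=> a i an ok; case: (ltngtP a.+1 x) => ax.
  + rewrite [hop g x a]hop_below in ok; last exact: ltnW.
    have Fi := levelsF G an ok; rewrite [hop g x a]hop_below; last exact: ltnW.
    rewrite [hop g x a.+1]hop_below //; move: Fi; rewrite /lattice_ineq hop_psum /incr.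
    by lia.
  + have [d Ed] : exists d, a = x + d by exists (a - x); rewrite subnKC.
    subst a; move: ok; rewrite -!addnS !hop_above !addnS => ok.
    have xn1 : x + d.+1 < n by rewrite addnS.
    have xn0 : x + d < n by apply: ltnW.
    have [h1 _] := hrow_can_hop (ltnW xn0).
    have l1 := hrow_linked xn0; have := hrow_linked xn1; rewrite addnS => l2.
    have -> : incr c x (x + d).+1 = c (x + d).+1 by rewrite /incr; lia.
    have -> : incr c x (x + d).+2 = c (x + d).+2 by rewrite /incr; lia.
    apply: (lattice_incr (n := n) (levelsI G xn0) (levelsI G an)) h1 l1 l2 ok.
    - by move=> j k; apply: levels_mono; apply: ltnW.
    - by move=> l nl; apply: levels_rows => //; apply: leq_trans nl.
    - exact: levelsC.
    - exact: levelsC.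
    - by move=> j; apply: (levelsF G an).
  + rewrite [hop g x a]hop_below -?ax // in ok *.
    have Fi := levelsF G an ok; have := lat (a := x); rewrite x_pos -{1}ax an => /(_ isT).
    have xn1 : x + 0 < n by rewrite addn0 -ax.
    rewrite ax hop_top -addn1 hop_above addn1 -ax.
    have := hrow_linked xn1; rewrite addn0 -ax => lk.
    have -> : incr c a.+1 a.+1 = (c a.+1).+1 by rewrite /incr; lia.
    have -> : incr c a.+1 a.+2 = c a.+2 by rewrite /incr; lia.
    move=> ll; move: Fi lk; rewrite /lattice_ineq !psum_incr !pcount_incr /linked /=.
    case: i ok => [|i] ok; last by lia.
    by rewrite !psumS !pcountS !psum0 !pcount0; lia.
- by move=> a /lat.
- elim=> [|a IH] an.
    case: (leqP x 1) => x1; last by rewrite hop_below // /incr; have := levelsM G an; lia.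
    have -> : 1 = x by apply/eqP; rewrite eqn_leq x_pos.
    have x1' : x = 1 by apply/eqP; rewrite eqn_leq x_pos x1.
    by rewrite hop_top /incr !eqxx x1'; have := levelsM G an; lia.
  case: (ltngtP a.+2 x) => ax.
  + by rewrite hop_below // /incr; have := levelsM G an; lia.
  + have [d Ed] : exists d, a.+1 = x + d by exists (a.+1 - x); rewrite subnKC.
    have := IH (ltnW an); have := levelsM G an; have := lat (a := a.+1).
    rewrite an => /(_ isT); rewrite Ed -addnS !hop_above addnS /incr.
    have /hrow_linked : x + d < n by rewrite -Ed.
    rewrite /linked; have := hrow_linked.
    by case: (hrow g x d) => [|r] l1 l2 l3 l4 l5; rewrite ?addnS; lia.
  + by rewrite ax hop_top /incr !eqxx -ax; have := levelsM G an; lia.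
Qed.

End Levels.

Lemma levels_init n : levels n (fun _ _ => 0) (fun _ => 0).
Proof.
have z f k : (forall l, f l = 0) -> psum f k = 0.
  by move=> h; rewrite (@psum_const _ 0) ?psum0.
split=> //.
- by move=> a _; rewrite !z.
- by move=> a i _ _; rewrite /lattice_ineq !z // pcountS !add0n leq_addr.
Qed.

(** With equal counts, interlacing makes each nonempty row grow by at least 1 and [lattice_ineq]
    bounds the partial sums of the growth from above by the same amount; the total gives the length
    of the new row. For [a = n] this is the doubled staircase. *)
Lemma levels_final n g c : levels n g c -> (forall a, 0 < a <= n -> c a = n) ->
  forall a i, a <= n -> i < a -> g a i + i.*2.+1 = n + a.
Proof.
move=> G cn a i an ia.
suff [H _] : (forall i, a <= n -> i < a -> g a i + i.*2.+1 = n + a) /\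
    (forall i, a < n -> i < a.+1 -> g a.+1 i + i.*2.+1 = n + a.+1) by apply: H.
clear i an ia; elim: a => [|a [IH0 IH1]]; split=> // i an.
  rewrite ltnS leqn0 => /eqP->.
  have := levelsC G an; rewrite cn // (@psum_const (g 0) 0) //; last by move=> l _; apply: (levels0 G).
  rewrite (@psum_const _ 1) //; last by move=> l l1; apply: (levels_rows G).
  by rewrite psumS !psum0; lia.
have an1 := ltnW an.
have e1 l : l < a -> g a.+1 l = (g a l).+1.
  by move=> la; have := IH0 l (ltnW an1) la; have := IH1 l an1 (ltnW la); lia.
have s1 l : l <= a -> psum (g a.+1) l = psum (g a) l + l.
  elim: l => [|l IHl] la; first by rewrite !psum0.
  by rewrite !psumS e1 // IHl ?(ltnW la) //; lia.
have up l : l <= a -> g a.+1 l < g a.+2 l.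
  by move=> la; apply: (levelsI G an l).2; have := IH1 l an1 la; lia.
have F l : l <= a -> psum (g a.+2) l.+1 <= psum (g a.+1) l.+1 + l.+1.
  move=> la; have := @levelsF _ _ _ G a l an; rewrite /lattice_ineq !cn; try lia.
  have -> : pcount (g a) l = l.
    by apply: pcount_full => k kl; have := IH0 k (ltnW an1) (leq_trans kl la); lia.
  have := pcount_le (g a.+1) l.+1; rewrite s1 // => h1 h2.
  have /h2 : (l == 0) || (0 < g a l.-1).
    case: (l) la => // k ka /=; have := IH0 k (ltnW an1) ka; lia.
  by lia.
have e2 l : l <= a.+1 -> psum (g a.+2) l = psum (g a.+1) l + l.
  elim: l => [|l IHl] la; first by rewrite !psum0.
  have := F l la; have := up l la; rewrite !psumS IHl ?(ltnW la) //; lia.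
rewrite ltnS leq_eqVlt => /orP[/eqP->|ia]; last first.
  have := e2 i (ltnW ia); have := e2 i.+1 ia; rewrite !psumS.
  by have := IH1 i an1 ia; lia.
have := levelsC G an; rewrite cn //.
rewrite (@psum_const _ a.+2) //; last by move=> l; apply: (levels_rows G).
rewrite (@psum_const (g a.+1) a.+1) //; last by move=> l; apply: (levels_rows G).
by rewrite psumS e2 //; lia.
Qed.

(** * Shifted shapes by rows and by diagonals *)

Fixpoint conts (L : nat -> nat) (rs : seq nat) : seq nat :=
  if rs is r :: rs' then L r :: conts (incr L r) rs' else [::].

Fixpoint rboxes (L : nat -> nat) (rs : seq nat) : seq (nat * nat) :=
  if rs is r :: rs' then (r, r + L r) :: rboxes (incr L r) rs' else [::].

Fixpoint boxes (m : nat -> nat) (w : seq nat) : seq (nat * nat) :=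
  if w is c :: w' then (m c, m c + c) :: boxes (incr m c) w' else [::].

Fixpoint hoppable (L : nat -> nat) (rs : seq nat) : bool :=
  if rs is r :: rs' then can_hop L r && hoppable (incr L r) rs' else true.

Definition strict_rows (L : nat -> nat) : Prop := forall r, L r.+1 <= (L r).-1.

(** The diagonals of a shifted shape start in row 0, so [m] counts by diagonals the shape that [L]
    gives by rows. *)
Definition same_shape (L m : nat -> nat) : Prop := forall r c, (r < m c) = (c < L r).

Lemma strict_rows_incr L r : strict_rows L -> can_hop L r -> strict_rows (incr L r).
Proof.
move=> s; rewrite /can_hop => cr i; have := s i; rewrite /incr.
have [E|n1] := eqVneq i.+1 r; last by lia.
by subst r; move: cr => /=; lia.
Qed.

Lemma same_shape_incr L m r : strict_rows L -> same_shape L m -> can_hop L r ->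
  [/\ m (L r) = r, m (L r).+1 = r, (L r == 0) || (m (L r).-1 == r.+1) &
      same_shape (incr L r) (incr m (L r))].
Proof.
move=> s h cr.
have h1 : m (L r) = r.
  apply/eqP; rewrite eqn_leq; apply/andP; split.
    by rewrite leqNgt h ltnn.
  by case: r cr => // r cr; rewrite h; move: cr; rewrite /can_hop /=; lia.
have h2 : m (L r).+1 = r.
  apply/eqP; rewrite eqn_leq; apply/andP; split.
    by rewrite leqNgt h -leqNgt leqnSn.
  by case: r cr {h1} => // r cr; rewrite h; move: cr; rewrite /can_hop /=.
split=> //.
  case: posnP => //= p; apply/eqP/eqP; rewrite eqn_leq; apply/andP; split.
    by rewrite leqNgt h; have := s r; lia.
  by rewrite h prednK.
move=> i c; rewrite /incr; have := h i c.
have [->|] := eqVneq c (L r); have [->|] := eqVneq i r; rewrite ?h1; try lia.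
Qed.

Lemma boxes_rows L m rs : strict_rows L -> same_shape L m -> hoppable L rs ->
  valid m (conts L rs) /\ boxes m (conts L rs) = rboxes L rs.
Proof.
elim: rs L m => [//|r rs IH] L m s h /= /andP[cr hr].
have [h1 h2 h3 h4] := same_shape_incr s h cr.
have [v ->] := IH _ _ (strict_rows_incr s cr) h4 hr.
by rewrite h1 h2 eqxx h3 v.
Qed.

Lemma same_shape_end L m rs : strict_rows L -> same_shape L m -> hoppable L rs ->
  same_shape (addw L rs) (addw m (conts L rs)).
Proof.
have add0 f : addw f [::] = f.
  by apply: functional_extensionality => x; rewrite /addw addn0.
have addS f y t : addw f (y :: t) = addw (incr f y) t.
  by apply: functional_extensionality => x; rewrite /addw /incr /= eq_sym addnA.
elim: rs L m => [|r rs IH] L m s h /=; first by rewrite !add0.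
move=> /andP[cr hr]; have [h1 h2 h3 h4] := same_shape_incr s h cr.
by rewrite !addS; apply: IH => //; apply: strict_rows_incr.
Qed.

(* The word of the empty cells in the course of the rectification consists of one
   block for each pair of consecutive levels e and f. *)
Fixpoint vrow (e f : nat -> nat) (M B : nat) : seq nat :=
  if B is B'.+1 then iota (f B) (e B' - f B) ++ vrow e f M B'
  else iota (f 0) (M - f 0).

Lemma push_far_iota s l c : [\/ l = 0, c.+1 < s | s + l < c] ->
  push (iota s l) c = (c, iota s l).
Proof.
move=> h; apply: push_far; apply/allP => u; rewrite mem_iota /near.
by case: h; lia.
Qed.

Section VrowPush.
Variables (e f : nat -> nat) (M k p : nat).
Hypotheses (em : forall i j, i <= j -> e j <= e i) (ef : interlaced e f).
Hypotheses (ck : can_hop e k) (lk : linked e f k p) (eM : k = 0 -> (e 0).+1 < M).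

Let up i : i < k -> (e k).+1 < f i.
Proof.
move=> ik; move: ck; rewrite /can_hop; case: (k) ik => // j ij /=.
by have := em (i := i) (j := j) ij; have := (ef i).2; lia.
Qed.

Let vrow_push_lt b : b < k ->
  push (vrow e f M b) (e k) = (e k, vrow (incr e k) (incr f p) M b).
Proof.
have pk : k <= p by case: lk => -[_ ->].
elim: b => [|b IHb] bk /=.
  rewrite push_far_iota; last by apply: Or32; apply: up.
  by rewrite /incr (_ : 0 == p = false) ?addn0 //; lia.
rewrite push_cat IHb ?(ltnW bk) //= push_far_iota; last by apply: Or32; apply: up.
by rewrite /incr (_ : b.+1 == p = false) 1?(_ : b == k = false) ?addn0 //; lia.
Qed.

Let vrow_push_eq : push (vrow e f M k) (e k) =
  if p == k then (f k, e k :: vrow (incr e k) (incr f p) M k)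
  else (e k, vrow (incr e k) (incr f p) M k).
Proof.
have top l : (e k).+1 < l ->
  push (iota (f k) (l - f k)) (e k) =
  if p == k then (f k, e k :: iota (f k).+1 (l - (f k).+1))
  else (e k, iota (f k) (l - f k)).
  move=> el; case: lk => -[l1 ->]; rewrite ?eqxx ?gtn_eqF //; last first.
    by rewrite push_far_iota //; apply: Or32.
  rewrite (_ : l - f k = (l - (f k).+1).+1) /=; last by lia.
  rewrite push_far_iota; last by apply: Or32; lia.
  by rewrite /near l1 eqxx.
have := eM; have := vrow_push_lt; have := ck; rewrite /can_hop.
case: (k) top => [|j] top /= cj lt eM0.
  rewrite top ?eM0 //; case: eqVneq => [->|/negPf n0]; rewrite /incr ?eqxx ?addn1 //.
  by rewrite (eq_sym 0) n0 addn0.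
rewrite push_cat lt //= top //; rewrite /incr (_ : j == j.+1 = false) ?addn0; last by lia.
case: eqVneq => [->|/negPf n0] /=; rewrite ?eqxx ?addn1 //.
by rewrite ?addn0.
Qed.

(** If [f k = (e k).+1], the letter meets its successor at the start of run [k], leaves as [f k],
    and the [e k] that stays behind lengthens run [k.+1]. Otherwise it passes run [k] and traverses
    run [k.+1] down to its first letter [f k.+1], or passes it unchanged if it is empty. *)
Lemma vrow_push B : k < B ->
  push (vrow e f M B) (e k) = (f p, vrow (incr e k) (incr f p) M B).
Proof.
elim: B => [//|b IHb]; rewrite ltnS leq_eqVlt => /orP[/eqP E|kb]; last first.
  rewrite /= push_cat IHb //= push_far_iota; last first.
    have := (ef b).1; have := em (i := k.+1) (j := b) kb; have := (ef k.+1).2.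
    have := (ef k).1; case: (posnP (e b)) => [->|]; first by move=> *; apply: Or31; lia.
    by case: lk => -[l1 ->] *; apply: Or33; lia.
  rewrite /incr (_ : b == k = false) ?addn0; last by lia.
  by rewrite (_ : b.+1 == p = false) ?addn0 //; case: lk; lia.
subst b => {IHb}; rewrite /= push_cat vrow_push_eq.
have := (ef k).1; have := (ef k).2; case: lk => -[l1 ->].
  rewrite eqxx /= => _ h; rewrite push_far_iota; last first.
    by have [E|] := eqVneq (e k - f k.+1) 0; [apply: Or31 | move=> ?; apply: Or33; lia].
  rewrite /incr eqxx (_ : k.+1 == k = false) ?addn0; last by lia.
  rewrite -[e k :: _]/([:: e k] ++ _) catA addn1 subSn // -[(e k - f k.+1).+1]addn1 iotaD /=.
  by rewrite subnKC.
rewrite (_ : k.+1 == k = false) /=; last by lia.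
move=> _ h; have := push_iota (f k.+1) (e k - f k.+1); rewrite subnKC // => ->.
by rewrite /incr !eqxx /= !addn1 subSS.
Qed.

End VrowPush.

(** The block where [x] enters: [M] is the content of the new box, and the run of row 0 is traversed
    down to [f 0], so that level [x] grows in row 0. *)
Lemma vrow_push_top e f M B : (forall i j, i <= j -> e j <= e i) ->
  interlaced e f -> f 0 <= M ->
  push (vrow e f M B) M = (f 0, vrow e (incr f 0) M.+1 B).
Proof.
move=> em ef fM; elim: B => [|B IH] /=.
  have := push_iota (f 0) (M - f 0); rewrite subnKC // => ->.
  by rewrite /incr eqxx addn1 subSS.
rewrite push_cat IH /= push_far_iota /incr ?addn0 //.
have := (ef B).1; have := em 0 B; have := (ef 0).2.
case: (posnP (e B)) => [->|]; first by move=> *; apply: Or31; lia.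
by move=> *; apply: Or33; lia.
Qed.

Lemma vrow_push_far e f M B c : (forall i j, i <= j -> e j <= e i) ->
  interlaced e f -> e 0 <= M -> M < c ->
  push (vrow e f M B) c = (c, vrow e f M B).
Proof.
move=> em ef eM Mc; elim: B => [|B IH] /=.
  apply: push_far_iota; case: (leqP M (f 0)) => h; [apply: Or31|apply: Or33]; lia.
rewrite push_cat IH /= push_far_iota //.
have := (ef B).1; have := em 0 B isT.
by case: (leqP (e B) (f B.+1)) => h *; [apply: Or31 | apply: Or33]; lia.
Qed.

(** Blocks of larger levels stand further left, so a pushed letter goes through the levels in
    increasing order. *)
Fixpoint ustate (g : nat -> nat -> nat) (c : nat -> nat) (B k : nat) : seq nat :=
  if k is j.+1 then vrow (g k) (g k.+1) (k + c k.+1) B ++ ustate g c B j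
  else [::].

Lemma ustate_init B k : ustate (fun _ _ => 0) (fun _ => 0) B k = stair k.
Proof.
elim: k => [//|k IH]; rewrite stairS -IH [LHS]/=; congr (_ ++ _).
rewrite addn0; elim: B {IH} => [|B IHB] //=.
Qed.

(** The blocks that end below level [x] are too far from the new content, the one that ends at level
    [x] turns it into the length of row 0, and each later block performs one step of [hrow]. For
    [x = 1] the content is the length of row 0 from the outset. *)
Lemma ustate_push n g c x k : levels n g c -> 0 < x <= n -> k < n ->
  (forall a, 0 < a < n -> incr c x a <= incr c x a.+1) ->
  push (ustate g c n k) (x.-1 + c x) =
  if k.+1 < x then (x.-1 + c x, ustate g c n k)
  else (g k.+1 (hrow g x (k.+1 - x)), ustate (hop g x) (incr c x) n k).
Proof.
move=> G /andP[x0 xn] kn lat.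
have em a : a <= n -> forall i j, i <= j -> g a j <= g a i.
  by move=> an i j; apply: (levels_mono G).
elim: k kn => [|k IH] kn.
  case: ltnP => // x1; have {x1} E : x = 1 by lia.
  rewrite E /= ?add0n ?subnn /=; congr (_, _); have := levelsC G kn.
  rewrite (@psum_const _ 1) //; last by move=> l; apply: (levels_rows G).
  rewrite (@psum_const (g 0) 0) //; last by move=> l _; apply: (levels0 G).
  by rewrite psumS !psum0.
rewrite [ustate g c n _]/= push_cat IH ?(ltnW kn) //.
have G' := levels_hop G x0 lat xn.
case: (ltngtP k.+2 x) => kx.
- rewrite /= vrow_push_far //; first by apply: em; apply: ltnW.
  + exact: (levelsI G).
  + by have := levelsM G (ltnW kn); have := levelsI G kn 0; have := levelsM G kn; lia.
  + have: c k.+2 <= c x.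
      have mono j : k.+2 + j <= n -> c k.+2 <= c (k.+2 + j).
        elim: j => [|j IHj]; rewrite ?addn0 // addnS => h.
        by apply: leq_trans (IHj (ltnW h)) _; apply: (levelsL G); lia.
      by rewrite -(subnKC (ltnW kx)); apply: mono; lia.
    by lia.
- rewrite /=.
  have [d Ed] : exists d, k.+1 = x + d by exists (k.+1 - x); lia.
  have xd : x + d < n by rewrite -Ed.
  have [ck _] := hrow_can_hop G x0 lat (ltnW xd).
have lk := hrow_linked G x0 lat xd.
  have -> : k.+1 - x = d by rewrite Ed addKn.
  have -> : k.+2 - x = d.+1 by rewrite subSn ?Ed ?addKn ?leq_addr.
  have -> : incr c x k.+2 = c k.+2 by rewrite /incr; lia.
  have hb : hop g x k.+1 = incr (g k.+1) (hrow g x d) by rewrite Ed hop_above.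
  have ha : hop g x k.+2 = incr (g k.+2) (hrow g x d.+1).
    by rewrite Ed -addnS hop_above.
  rewrite -Ed in ck lk.
  rewrite (vrow_push (em _ (ltnW kn)) (levelsI G kn) ck lk) /= ?hb ?ha //.
    (* The strict bound on row 0 is the field [levelsM] after the insertion, combined with the
       lattice condition between the two letters. *)
    move=> r0; have := levelsM G' (ltnW kn); have := lat k.+1; rewrite kn hb /incr r0 eqxx.
    by lia.
  have := hrow_bound G x0 lat (a := x + d); rewrite addKn leq_addr -Ed.
  by lia.
- rewrite -kx /= vrow_push_top; last 3 first.
  + exact: (em _ (ltnW kn)).
  + exact: (levelsI G kn).
  + exact: (levelsM G kn).
  rewrite subnn /=; congr (_, _ ++ _).
    have -> : incr c k.+2 k.+2 = (c k.+2).+1 by rewrite /incr eqxx addn1.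
    rewrite addnS; congr (vrow _ _ _ _).
      by apply: functional_extensionality => i; rewrite hop_below.
    by rewrite hop_top.
  have loc j : j < k.+1 -> ustate g c n j = ustate (hop g k.+2) (incr c k.+2) n j.
    elim: j => [//|j IHj] jk /=; rewrite -IHj ?(ltnW jk) // !hop_below; try lia.
    by congr (vrow _ _ _ _ ++ _); rewrite /incr; lia.
  exact: loc.
Qed.

(** * Rectification of the content word of Q(w) *)

Fixpoint lattice (n : nat) (c : nat -> nat) (w : seq nat) : bool :=
  if w is x :: w' then
    [&& 0 < x <= n, all (fun a => incr c x a <= incr c x a.+1) (iota 1 n.-1)
      & lattice n (incr c x) w']
  else true.

Fixpoint hrows (n : nat) (g : nat -> nat -> nat) (w : seq nat) : seq nat :=
  if w is x :: w' then hrow g x (n - x) :: hrows n (hop g x) w' else [::].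

Fixpoint wcont (c : nat -> nat) (w : seq nat) : seq nat :=
  if w is x :: w' then (x.-1 + c x) :: wcont (incr c x) w' else [::].

Lemma lattice_step n c x w : lattice n c (x :: w) ->
  [/\ 0 < x <= n, forall a, 0 < a < n -> incr c x a <= incr c x a.+1
    & lattice n (incr c x) w].
Proof.
move=> /= /and3P[-> /allP h ->]; split=> // a an; apply: h.
by rewrite mem_iota; lia.
Qed.

Lemma hop_last n g x : x <= n -> hop g x n = incr (g n) (hrow g x (n - x)).
Proof. by move=> xn; rewrite -{1 2}(subnKC xn) hop_above. Qed.

Lemma rect_wcont n g c w : 0 < n -> levels n g c -> lattice n c w ->
  rect (ustate g c n n.-1) (wcont c w) = conts (g n) (hrows n g w) /\
  hoppable (g n) (hrows n g w).
Proof.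
move=> n0; elim: w g c => [//|x w IH] g c G /lattice_step[xn lat lw].
case/andP: (xn) => x0 xn'.
rewrite /= (ustate_push G xn _ lat) ?prednK // ltnNge xn' /=.
have [-> h] := IH _ _ (levels_hop G x0 lat xn') lw.
rewrite hop_last // in h *; split=> //; rewrite h andbT.
have := hrow_can_hop G x0 lat (d := n - x); rewrite subnKC // => /(_ (leqnn _)).
by case.
Qed.

Lemma addw_cons m x w : addw m (x :: w) = addw (incr m x) w.
Proof.
by apply: functional_extensionality => y; rewrite /addw /incr /= eq_sym addnA.
Qed.

Lemma addw_nil m : addw m [::] = m.
Proof. by apply: functional_extensionality => y; rewrite /addw addn0. Qed.

Lemma levels_foldl n g c w : levels n g c -> lattice n c w ->
  levels n (foldl hop g w) (addw c w).
Proof.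
elim: w g c => [|x w IH] g c G /=; first by rewrite addw_nil.
move=> /(lattice_step (w := w))[/andP[x0 xn] lat lw]; rewrite addw_cons; apply: IH => //.
exact: levels_hop.
Qed.

Lemma hrows_end n g c w : lattice n c w -> foldl hop g w n = addw (g n) (hrows n g w).
Proof.
elim: w g c => [|x w IH] g c /=; first by rewrite addw_nil.
move=> /(lattice_step (w := w))[/andP[_ xn] _ lw].
by rewrite addw_cons -hop_last // (IH _ _ lw).
Qed.

Lemma size_hrows n g w : size (hrows n g w) = size w.
Proof. by elim: w g => //= x w IH g; rewrite IH. Qed.

Lemma size_conts L rs : size (conts L rs) = size rs.
Proof. by elim: rs L => //= r rs IH L; rewrite IH. Qed.

Lemma same_shape_inj L L' m m' : (forall r, L r = L' r) -> same_shape L m ->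
  same_shape L' m' -> m =1 m'.
Proof.
move=> e h h' c; apply/eqP; rewrite eqn_leq (leqNgt (m c)) (leqNgt (m' c)).
by rewrite h h' e -h' -e -h !ltnn.
Qed.

(* the content word of H(Q(w)) *)
Definition level_hops n w := conts (fun _ => 0) (hrows n (fun _ _ => 0) w).

Lemma level_hops_spec n w : 0 < n -> lattice n (fun _ => 0) w ->
  [/\ level_hops n w = rect (stair n.-1) (wcont (fun _ => 0) w),
      valid (fun _ => 0) (level_hops n w) &
      boxes (fun _ => 0) (level_hops n w) =
      rboxes (fun _ => 0) (hrows n (fun _ _ => 0) w)].
Proof.
move=> n0 lw; have [e h] := rect_wcont n0 (levels_init n) lw.
rewrite ustate_init in e; rewrite e.
have [v b] : valid (fun _ => 0) (level_hops n w) /\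
    boxes (fun _ => 0) (level_hops n w) = rboxes (fun _ => 0) (hrows n (fun _ _ => 0) w).
  exact: boxes_rows h.
by split.
Qed.

(** By [levels_final] both words fill the same shape, and a shape determines how often each content
    occurs. *)
Lemma level_hops_perm n w w' : 0 < n ->
  lattice n (fun _ => 0) w -> lattice n (fun _ => 0) w' ->
  (forall a, 0 < a <= n -> count_mem a w = n) ->
  (forall a, 0 < a <= n -> count_mem a w' = n) ->
  perm_eq (level_hops n w) (level_hops n w').
Proof.
move=> n0 lw lw' cw cw'.
have e r : foldl hop (fun _ _ => 0) w n r = foldl hop (fun _ _ => 0) w' n r.
  have G := levels_foldl (levels_init n) lw.
  have G' := levels_foldl (levels_init n) lw'.
  case: (ltnP r n) => rn; last by rewrite (levels_rows G) ?(levels_rows G').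
  have := levels_final G cw (leqnn n) rn; have := levels_final G' cw' (leqnn n) rn.
  by lia.
have S v : lattice n (fun _ => 0) v ->
    same_shape (foldl hop (fun _ _ => 0) v n) (addw (fun _ => 0) (level_hops n v)).
  move=> lv; rewrite (hrows_end _ lv); apply: same_shape_end => //.
  by have [] := rect_wcont n0 (levels_init n) lv.
have := same_shape_inj e (S _ lw) (S _ lw') => E.
by apply/allP => x _ /=; have := E x; rewrite /addw !add0n => ->.
Qed.

Lemma level_hops_promotion n w w' : 0 < n ->
  valid (fun _ => 0) (stair n.-1 ++ wcont (fun _ => 0) w) ->
  lattice n (fun _ => 0) w -> lattice n (fun _ => 0) w' ->
  (forall a, 0 < a <= n -> count_mem a w = n) ->
  (forall a, 0 < a <= n -> count_mem a w' = n) ->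
  (exists2 s, wcont (fun _ => 0) w = n.-1 :: s & wcont (fun _ => 0) w' = jdt n.-1 s) ->
  exists x t, level_hops n w = x :: t /\ level_hops n w' = jdt x t.
Proof.
move=> n0 v lw lw' cw cw' [s e e']; have := level_hops_perm n0 lw' lw cw' cw.
have [-> _ _] := level_hops_spec n0 lw; have [-> _ _] := level_hops_spec n0 lw'.
rewrite e e'; apply: rect_stair_jdt; by rewrite -e.
Qed.

(** * Sliding boxes *)

Notation box := (nat * nat)%type.

Definition next_to (p q : box) : bool := (q == (p.1, p.2.+1)) || (q == (p.1.+1, p.2)).

Definition fill (bs : seq box) : filling :=
  fun i j => if (i, j) \in bs then Some (index (i, j) bs).+1 else None.

(** The smaller neighbour of the empty box is the one that comes first in the list, so a slide is a
    single pass without comparison of labels. *)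
Fixpoint slide_boxes (p : box) (bs : seq box) : seq box * box :=
  if bs is b :: bs' then
    if next_to p b then (p :: (slide_boxes b bs').1, (slide_boxes b bs').2)
    else (b :: (slide_boxes p bs').1, (slide_boxes p bs').2)
  else ([::], p).

(** Standardness of the filling: no box precedes its left or upper neighbour. *)
Definition linear (bs : seq box) : bool :=
  uniq bs && pairwise (fun p q => ~~ next_to q p) bs.

Lemma filling_ext (T T' : filling) : T =2 T' -> T = T'.
Proof.
by move=> h; apply: functional_extensionality => i; apply: functional_extensionality => j.
Qed.

Lemma linear_cat_cons bs1 p bs2 : linear (bs1 ++ p :: bs2) ->
  [/\ p \notin bs1, forall q, q \in bs1 -> ~~ next_to p q,
      p \notin bs2 & forall q, q \in bs2 -> ~~ next_to q p].
Proof.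
rewrite /linear cat_uniq pairwise_cat /= => /and4P[/and4P[_ + -> _]].
rewrite negb_or => /andP[-> _] + _ /andP[/allP h _] => /allrelP h'.
by split=> // q hq; apply: h' => //; rewrite mem_head.
Qed.

Lemma fill_cat bs1 b bs2 : b \notin bs1 -> fill (bs1 ++ b :: bs2) b.1 b.2 = Some (size bs1).+1.
Proof.
move=> h; rewrite /fill -surjective_pairing mem_cat mem_head orbT.
by rewrite index_cat (negbTE h) /= eqxx addn0.
Qed.

Lemma fill_later bs1 b bs2 q k : q \notin bs1 -> q != b ->
  fill (bs1 ++ b :: bs2) q.1 q.2 = Some k -> (size bs1).+1 < k.
Proof.
move=> h qb; rewrite /fill -surjective_pairing; case: ifP => // _ [<-].
by rewrite index_cat (negbTE h) /= eq_sym (negbTE qb) addnS !ltnS leq_addr.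
Qed.

Lemma slide_source_fill bs1 p b bs2 : linear (bs1 ++ p :: b :: bs2) -> next_to p b ->
  slide_source (fill (bs1 ++ b :: bs2)) p.1 p.2 = Some b.
Proof.
move=> lin pb; have [_ h1 _ _] := linear_cat_cons lin.
have b1 : b \notin bs1 by apply/negP => /h1; rewrite pb.
have [nr nd] : (p.1, p.2.+1) \notin bs1 /\ (p.1.+1, p.2) \notin bs1.
  by split; apply/negP => /h1; rewrite /next_to eqxx ?orbT.
have Tb := fill_cat bs2 b1; rewrite /slide_source.
case/orP: pb => /eqP E; rewrite E /= in Tb b1 *; rewrite Tb.
  case Ed: (fill _ p.1.+1 p.2) => [k|//].
  have := @fill_later bs1 (p.1, p.2.+1) bs2 (p.1.+1, p.2) k nd; rewrite xpair_eqE.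
  by rewrite [p.1.+1 == _]gtn_eqF // => /(_ isT Ed) ->.
case Ed: (fill _ p.1 p.2.+1) => [k|//].
have := @fill_later bs1 (p.1.+1, p.2) bs2 (p.1, p.2.+1) k nr; rewrite xpair_eqE.
by rewrite [p.1 == _]ltn_eqF // => /(_ isT Ed) h; rewrite ltnNge ltnW.
Qed.

Lemma slide_move_fill bs1 p b bs2 : linear (bs1 ++ p :: b :: bs2) ->
  let T := fill (bs1 ++ b :: bs2) in
  set_box (set_box T p.1 p.2 (T b.1 b.2)) b.1 b.2 None = fill (bs1 ++ p :: bs2).
Proof.
move=> lin /=; have [p1 _ p2 _] := linear_cat_cons lin.
have lin' : linear ((bs1 ++ [:: p]) ++ b :: bs2) by rewrite -catA.
have [b1 _ b2 _] := linear_cat_cons lin'.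
have bp : b != p by apply: contraNneq p2 => ->; rewrite mem_head.
have nb1 : b \notin bs1 by apply: contra b1; rewrite mem_cat => ->.
apply: filling_ext => i j; rewrite /set_box fill_cat //.
rewrite -!xpair_eqE -!surjective_pairing /fill !mem_cat !inE !index_cat /=.
have [->|nb] := eqVneq (i, j) b; first by rewrite (negbTE bp) (negbTE nb1) (negbTE b2).
have [->|np] := eqVneq (i, j) p; first by rewrite (negbTE p1) /= addn0.
by [].
Qed.

Lemma linear_swap bs1 p b bs2 : ~~ next_to p b ->
  linear (bs1 ++ p :: b :: bs2) -> linear (bs1 ++ b :: p :: bs2).
Proof.
move=> pb /andP[u]; rewrite /linear pairwise_cat /= !allrel_consr.
move=> /and3P[/and3P[a1 a2 a3] a4 /and3P[/andP[_ a5] a6 a7]].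
rewrite pairwise_cat /= !allrel_consr a1 a2 a3 a4 a5 a6 a7 pb !andbT.
by rewrite -(perm_uniq (s1 := bs1 ++ [:: p, b & bs2])) // perm_cat2l;
  apply/permP => q /=; lia.
Qed.

Lemma slide_fill fuel bs1 bs2 p : size bs2 <= fuel -> linear (bs1 ++ p :: bs2) ->
  slide fuel (fill (bs1 ++ bs2)) p.1 p.2 =
    (fill (bs1 ++ (slide_boxes p bs2).1), (slide_boxes p bs2).2).
Proof.
elim: bs2 fuel bs1 p => [|b bs2 IH] fuel bs1 p /=.
  move=> _ lin; have [_ h _ _] := linear_cat_cons lin.
  rewrite cats0; case: fuel => [|fuel] /=; first by case: p {lin h}.
  have N q : next_to p q -> fill bs1 q.1 q.2 = None.
    by move=> pq; rewrite /fill -surjective_pairing; case: ifP => // /h; rewrite pq.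
  rewrite /slide_source (N (p.1, p.2.+1)) ?(N (p.1.+1, p.2)) /next_to ?eqxx ?orbT //.
  by case: p {lin h N}.
case: ifP => pb sz lin.
  case: fuel sz => // fuel sz; rewrite [slide _ _ _ _]/= slide_source_fill //.
  case: b pb sz lin => k l pb sz lin; rewrite (slide_move_fill lin).
  by rewrite -[k]/((k, l).1) -{2}[l]/((k, l).2) -cat_rcons IH // cat_rcons // cat_rcons.
(* A box that is not a neighbour stays in place: it joins the prefix, and the empty box is moved
   behind it in the list. *)
rewrite -!cat_rcons IH ?cat_rcons //; first exact: ltnW.
exact: linear_swap (negbT pb) lin.
Qed.

Lemma size_slide_boxes p bs : size (slide_boxes p bs).1 = size bs.
Proof. by elim: bs p => [//|b bs IH] p /=; case: ifP => _ /=; rewrite IH. Qed.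

Lemma promotion_fill bs N : size bs < N -> linear ((0, 0) :: bs) ->
  promotion N (fill ((0, 0) :: bs)) =
  set_box (fill (slide_boxes (0, 0) bs).1)
     (slide_boxes (0, 0) bs).2.1 (slide_boxes (0, 0) bs).2.2 (Some N).
Proof.
move=> sz lin; have [_ _ p0 _] := @linear_cat_cons [::] _ _ lin; rewrite /promotion.
have -> : set_box (fun i j => omap predn (fill ((0, 0) :: bs) i j)) 0 0 None = fill bs.
  apply: filling_ext => i j; rewrite /set_box -xpair_eqE /fill inE.
  have [->|n0] := eqVneq (i, j) (0, 0); first by rewrite (negbTE p0).
  have -> : index (i, j) ((0, 0) :: bs) = (index (i, j) bs).+1.
    by rewrite [LHS]/index [find _ _]/= /pred1 /= eq_sym (negbTE n0).
  by rewrite orFb; case: ifP.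
have -> : slide N (fill bs) 0 0 =
    (fill (slide_boxes (0, 0) bs).1, (slide_boxes (0, 0) bs).2).
  exact: (@slide_fill N [::] bs (0, 0) (ltnW sz) lin).
by case: (slide_boxes _ _).2.
Qed.

Lemma fill_rcons bs p : p \notin bs ->
  set_box (fill bs) p.1 p.2 (Some (size bs).+1) = fill (rcons bs p).
Proof.
move=> pb; apply: filling_ext => i j; rewrite /set_box -xpair_eqE -surjective_pairing.
rewrite /fill mem_rcons inE -cats1 index_cat.
have [->|n0] := eqVneq (i, j) p; first by rewrite (negbTE pb) /= eqxx addn0.
by rewrite orFb; case: ifP.
Qed.

Definition promote_boxes (p : box) (bs : seq box) : seq box :=
  rcons (slide_boxes p bs).1 (slide_boxes p bs).2.

Lemma promote_boxes_cons p b bs : promote_boxes p (b :: bs) =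
  if next_to p b then p :: promote_boxes b bs else b :: promote_boxes p bs.
Proof. by rewrite /promote_boxes /=; case: ifP. Qed.

Lemma promote_boxes_perm p bs : perm_eq (p :: bs) (promote_boxes p bs).
Proof.
elim: bs p => [//|b bs IH] p; rewrite promote_boxes_cons; case: ifP => _.
  by rewrite perm_cons.
have /perm_trans : perm_eq [:: p, b & bs] [:: b, p & bs] by apply/permP => q /=; lia.
by apply; rewrite perm_cons.
Qed.

Lemma promotion_fill_promote bs : linear ((0, 0) :: bs) ->
  promotion (size bs).+1 (fill ((0, 0) :: bs)) = fill (promote_boxes (0, 0) bs).
Proof.
move=> lin; rewrite promotion_fill // -(size_slide_boxes (0, 0)) fill_rcons //.
have /andP[+ _] := lin.
by rewrite (perm_uniq (promote_boxes_perm _ _)) rcons_uniq => /andP[].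
Qed.

Lemma boxes_cat m s t : boxes m (s ++ t) = boxes m s ++ boxes (addw m s) t.
Proof.
elim: s m => [|c s IH] m /=; first by rewrite addw_nil.
by rewrite IH addw_cons.
Qed.

Lemma size_boxes m s : size (boxes m s) = size s.
Proof. by elim: s m => //= c s IH m; rewrite IH. Qed.

Lemma boxes_linear m s : valid m s -> linear (boxes m s).
Proof.
elim: s m => [//|c s IH] m /= /and3P[/eqP h1 h2 /IH].
rewrite /linear /= => /andP[-> ->]; rewrite !andbT; apply/andP.
have far q : q \in boxes (incr m c) s -> exists d k, q = (k, k + d) /\ incr m c d <= k.
  elim: s (incr m c) {IH} => [//|d s IH] m' /=.
  rewrite inE => /orP[/eqP->|/IH[e [k [-> h]]]]; first by exists d, (m' d).
  by exists e, k; split=> //; apply: leq_trans h; rewrite /incr leq_addr.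
split; first (apply/negP => /far[d [k [[E1 E2]]]]); last (apply/allP => q /far[d [k [-> h]]]).
  have -> : d = c by lia.
  by rewrite /incr eqxx; lia.
rewrite /next_to !xpair_eqE /= negb_or; move: h; rewrite /incr.
have [->|nd1] := eqVneq d c; first by lia.
have [->|nd2] := eqVneq d c.+1; first by lia.
have [E|nd3] := eqVneq d.+1 c; last by lia.
by subst c; move: h2 => /=; lia.
Qed.

(** If the next content is adjacent to [x], the equalities in [valid] fix its row, and its box is a
    neighbour of that of [x]. Otherwise the two letters commute, which keeps [x] immediately before
    the rest. *)
Lemma boxes_jdt m x s : valid m (x :: s) ->
  boxes m (jdt x s) = promote_boxes (m x, m x + x) (boxes (incr m x) s).
Proof.
elim: s m x => [//|b s IH] m x v; rewrite [jdt _ _]/= [boxes (incr m x) _]/=.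
rewrite promote_boxes_cons.
have xb : x <> b.
  by move=> E; move: v; rewrite E => /(@valid_repeat _ _ [::]).
have nE : next_to (m x, m x + x) (incr m x b, incr m x b + b) = near x b.
  move: v xb => /= /and5P[/eqP h1 h2 /eqP h3 h4 _] xb.
  rewrite /next_to !xpair_eqE /near /=.
  apply/idP/idP; rewrite /incr in h3 h4 *; first by case: (b == x) => /=; lia.
  case/orP=> /eqP E; subst; last by rewrite -h1; lia.
  by move: h2; rewrite /=; lia.
rewrite nE; case: ifP => nb.
  by rewrite [LHS]/= IH //; move: v => /= /and3P[].
have v' := valid_swap (negbT nb) v.
have e1 : incr m x b = m b by rewrite /incr; lia.
have e2 : incr m b x = m x by rewrite /incr; lia.
have e3 : incr (incr m x) b = incr (incr m b) x.
  by apply: functional_extensionality => z; rewrite /incr; lia.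
rewrite [LHS]/= e1 IH; last by move: v' => /= /and3P[].
by rewrite e2 e3.
Qed.

Lemma foldl_slide N U s : size s <= N -> valid (fun _ => 0) (U ++ s) ->
  foldl (fun T c => (slide N T c.1 c.2).1) (fill (boxes (addw (fun _ => 0) U) s))
    (rev (boxes (fun _ => 0) U)) = fill (boxes (fun _ => 0) (rect U s)).
Proof.
elim/last_ind: U s => [|U u IH] s sN.
  move=> _ /=; rewrite addw_nil; congr (fill (boxes _ _)).
  by elim: s {sN} => //= b s <-.
rewrite cat_rcons => v; rewrite -!cats1 boxes_cat rev_cat /= rect_catl.
set m := addw (fun _ => 0) U.
have vm : valid m (u :: s) by move: v; rewrite valid_cat => /andP[].
have -> : addw (fun _ => 0) (U ++ [:: u]) = incr m u.
  apply: functional_extensionality => z; rewrite /m /addw /incr count_cat /= (eq_sym z).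
  by lia.
have lin := boxes_linear vm.
have := @slide_fill N [::] (boxes (incr m u) s) (m u, m u + u).
rewrite size_boxes => /(_ sN lin) /= ->.
(* [promote_boxes] also lists the vacated cell, in the last place; here this cell is dropped. *)
have E : (slide_boxes (m u, m u + u) (boxes (incr m u) s)).1 = boxes m (rect [:: u] s).
  have := boxes_jdt vm; rewrite jdtE boxes_cat /promote_boxes -cats1.
  move/eqP; rewrite eqseq_cat; first by case/andP => /eqP->.
  by rewrite size_slide_boxes !size_boxes size_rect.
rewrite E [LHS]/=; apply: IH; first by rewrite size_rect.
have := v; rewrite !valid_cat => /andP[-> v2] /=.
have := @rect_valid m [:: u] s v2; by rewrite valid_cat => /andP[].
Qed.

Lemma haiman_inner_cellsE n : haiman_inner_cells n = rev (boxes (fun _ => 0) (stair n.-1)).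
Proof.
rewrite /haiman_inner_cells; congr rev.
have row m i k l : (forall c, l <= c < l + k -> m c = i) ->
    boxes m (iota l k) = [seq (i, j) | j <- iota (i + l) k].
  elim: k m l => [//|k IH] m l h /=; rewrite h; last by lia.
  rewrite -addnS; congr cons; apply: IH => c cl; rewrite /incr h; lia.
suff H k i m : (forall c, c < k -> m c = i) ->
   boxes m (stair k) = [seq (i', j) | i' <- iota i k, j <- iota i' (k + i - i')].
  rewrite (H _ 0) //; congr flatten; apply: eq_map => i; by rewrite addn0.
elim: k i m => [//|k IH] i m h; rewrite stairS boxes_cat (row _ i); last first.
  by move=> c /andP[_ ck]; apply: h.
rewrite (IH i.+1); last first.
  move=> c ck; rewrite /addw h; last exact: ltnW.
  by rewrite count_uniq_mem ?iota_uniq // mem_iota /= add0n ltnW // addn1.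
rewrite [iota i k.+1]/= [RHS]/= addnK addn0; congr (_ ++ _).
by congr flatten; apply: eq_map => i'; rewrite addnS addSn.
Qed.

(** * The boxes of Q(w) in the skew shifted shape *)

Fixpoint sqboxes (n : nat) (c : nat -> nat) (w : seq nat) : seq box :=
  if w is x :: w' then (n - x, c x) :: sqboxes n (incr c x) w' else [::].

Definition shift_box (n : nat) (p : box) : box := (p.1, p.2 + n.-1).

Lemma shift_box_inj n : injective (shift_box n).
Proof. by move=> [a b] [a' b'] [-> /addIn ->]. Qed.

Lemma haiman_skew_fill n bs : haiman_skew n (fill bs) = fill (map (shift_box n) bs).
Proof.
apply: filling_ext => i j; rewrite /haiman_skew /fill; case: leqP => nj.
  have -> : (i, j) = shift_box n (i, j - n.-1) by rewrite /shift_box /= subnK.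
  by rewrite mem_map ?index_map //; apply: shift_box_inj.
by case: ifP => // /mapP[[a b] _ [_ E]]; lia.
Qed.

Lemma stair_count k c : count_mem c (stair k) = k - c.
Proof.
elim: k => [//|k IH]; rewrite stairS count_cat IH count_uniq_mem ?iota_uniq // mem_iota.
by lia.
Qed.

Lemma stair_valid k i m : (forall c, c <= k -> m c = i) -> valid m (stair k).
Proof.
have row m' i' l k' : (forall c, l <= c <= l + k' -> m' c = i') ->
    (l == 0) || (m' l.-1 == i'.+1) -> valid m' (iota l k').
  elim: k' m' l => [//|k' IH] m' l h hl /=.
  rewrite [m' l]h ?[m' l.+1]h ?eqxx ?hl /=; try lia.
  apply: IH; last by rewrite /= /incr eqxx h ?addn1 ?eqxx //; lia.
  by move=> c lc; rewrite /incr h; lia.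
elim: k i m => [//|k IH] i m h; rewrite stairS valid_cat; apply/andP; split.
  by apply: (row _ i) => // c /andP[_ ck]; apply: h.
apply: (IH i.+1) => c ck; rewrite /addw h; last exact: leqW.
by rewrite count_uniq_mem ?iota_uniq // mem_iota /= add0n ltnS ck addn1.
Qed.

Section SquareWords.
Variable n : nat.
Hypothesis n_pos : 0 < n.

(** Row lengths of the skew shape with the empty staircase cells counted in; row [r] is that of the
    letter [n - r]. *)
Definition srows (c : nat -> nat) (L : nat -> nat) : Prop :=
  forall r, r < n -> L r = n.-1 - r + c (n - r).

Lemma srows_incr c L x : 0 < x <= n -> srows c L -> srows (incr c x) (incr L (n - x)).
Proof. by move=> xn h r rn; rewrite /incr h //; lia. Qed.

Lemma wcont_rows c L w : srows c L -> lattice n c w ->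
  [/\ conts L (map (subn n) w) = wcont c w, hoppable L (map (subn n) w)
    & rboxes L (map (subn n) w) = map (shift_box n) (sqboxes n c w)].
Proof.
elim: w c L => [//|x w IH] c L h /lattice_step[xn lat lw].
have [e1 e2 e3] := IH _ _ (srows_incr xn h) lw.
have Lx : L (n - x) = x.-1 + c x by rewrite h ?subKn; lia.
rewrite /= e1 e2 e3 Lx; split=> //; last first.
  by congr cons; rewrite /shift_box /=; congr pair; lia.
rewrite andbT /can_hop Lx; have [//|ne] := eqVneq (n - x) 0.
have := lat x; rewrite h; last by lia.
have -> : n - (n - x).-1 = x.+1 by lia.
by rewrite /incr /=; lia.
Qed.

Lemma wcont_spec w : lattice n (fun _ => 0) w ->
  let m := addw (fun _ => 0) (stair n.-1) in
  boxes m (wcont (fun _ => 0) w) = map (shift_box n) (sqboxes n (fun _ => 0) w) /\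
  valid (fun _ => 0) (stair n.-1 ++ wcont (fun _ => 0) w).
Proof.
move=> lw m; pose L r := n.-1 - r.
have sL : srows (fun _ => 0) L by move=> r _; rewrite addn0.
have [e1 e2 e3] := wcont_rows sL lw.
have mE c : m c = n.-1 - c by rewrite /m /addw stair_count.
have [] := @boxes_rows L m (map (subn n) w) => //.
- by move=> r; rewrite /L; lia.
- by move=> r c; rewrite mE /L; lia.
rewrite e1 e3 => v ->; split=> //; rewrite valid_cat v andbT.
by apply: (@stair_valid _ 0).
Qed.

End SquareWords.

(** * Mixed insertion *)

Definition entry (P : tableau) (i y : nat) : nat := nth 0 (nth [::] P i) y.

Lemma shifted_entryE P i y : shifted_entry P i (i + y) = entry P i y.
Proof. by rewrite /shifted_entry leq_addr addKn. Qed.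

Lemma set_shifted_entryE P i y v i' y' :
  entry (set_shifted_entry P i (i + y) v) i' y' =
  if (i' == i) && (y' == y) then v else entry P i' y'.
Proof.
rewrite /entry /set_shifted_entry addKn nth_set_nth /=.
by case: (eqVneq i' i) => [->|//]; rewrite nth_set_nth /=.
Qed.

Lemma size_set_shifted_entry P i y v i' :
  size (nth [::] (set_shifted_entry P i (i + y) v) i') =
  if i' == i then maxn y.+1 (size (nth [::] P i)) else size (nth [::] P i').
Proof.
rewrite /set_shifted_entry addKn nth_set_nth /=.
by case: (eqVneq i' i) => [_|//]; rewrite size_set_nth.
Qed.

(* In row i the letter a occupies the offsets from G a.-1 i to G a i; its first
   occurrence is primed, unless it is on the diagonal.  In the course of an
   insertion, the letters b of row r may be all unprimed. *)
Definition mixed_tableau (n : nat) (G : nat -> nat -> nat) (b r : nat) (P : tableau) : Prop :=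
  (forall i, size (nth [::] P i) = G n i) /\
  (forall a i y, a < n -> G a i <= y < G a.+1 i -> entry P i y =
     a.+1.*2 - [&& y == G a i, 0 < y & ~~ ((a.+1 == b) && (i == r))]).

Definition bump_level (G : nat -> nat -> nat) (b i : nat) : nat -> nat -> nat :=
  fun a k => G a k + ((a == b) && (k == i)).

Lemma find_iota (p : pred nat) (f : nat -> nat) r k : r < k ->
  (forall i, i < r -> p (f i) = false) -> p (f r) -> find p (map f (iota 0 k)) = r.
Proof.
move=> rk low top; rewrite find_map -(subnKC (ltnW rk)) iotaD find_cat add0n.
rewrite (_ : has _ _ = false); last first.
  by apply/hasP => -[i]; rewrite mem_iota /= => ir; rewrite low.
rewrite size_iota; case: (k - r) (subn_gt0 r k) => [|d _]; first by rewrite rk.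
by rewrite /= top addn0.
Qed.

Section Steps.
Variables (n : nat) (G : nat -> nat -> nat) (P : tableau).
Hypothesis G0 : forall i, G 0 i = 0.
Hypothesis G_mono : forall a i, a < n -> G a i <= G a.+1 i.

Lemma level_of i y : y < G n i -> exists2 a, a < n & G a i <= y < G a.+1 i.
Proof.
move=> yn; have : exists a, y < G a i by exists n.
move=> /ex_minnP[[|a] h1 h2]; first by rewrite G0 in h1.
exists a; first exact: h2.
by rewrite h1 andbT leqNgt; apply/negP => /h2; rewrite ltnn.
Qed.

Lemma G_mono_leq a b i : a <= b <= n -> G a i <= G b i.
Proof.
case/andP; elim: b => [|b IH]; first by rewrite leqn0 => /eqP->.
rewrite leq_eqVlt => /orP[/eqP->//|ab bn].
exact: leq_trans (IH ab (ltnW bn)) (G_mono _ bn).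
Qed.

Lemma entry_bounds b r i y : mixed_tableau n G b r P -> y < G n i ->
  forall a, a <= n -> (y < G a i -> 0 < entry P i y <= a.*2) /\
                      (G a i <= y -> a.*2 < entry P i y).
Proof.
move=> [_ hE] yn a an; have [k kn hk] := level_of yn.
rewrite (hE _ _ _ kn hk); split => ya.
  have : k < a.
    rewrite ltnNge; apply/negP => ak; have := @G_mono_leq a k i; rewrite ak (ltnW kn).
    by move=> /(_ isT); lia.
  by move: hk; case: eqP; lia.
have : a <= k.
  rewrite leqNgt; apply/negP => ka; have := @G_mono_leq k.+1 a i; rewrite ka an.
  by move=> /(_ isT); lia.
by move: hk; case: eqP; lia.
Qed.

Lemma row_find b r i a : mixed_tableau n G b r P -> a <= n ->
  find (fun y => (y == 0) || (a.*2 < y)) (nth [::] P i) = G a i.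
Proof.
move=> hP an; have szE := hP.1 i; set s := nth [::] P i.
have Ga : G a i <= size s by rewrite szE; apply: G_mono_leq; rewrite an leqnn.
have H y : y < G n i -> (nth 0 s y == 0) || (a.*2 < nth 0 s y) = (G a i <= y).
  move=> yn; have [h1 h2] := entry_bounds hP yn an; rewrite -/(entry P i y).
  by case: (leqP (G a i) y) => h; [have := h2 h | have := h1 h]; lia.
apply/eqP; rewrite eqn_leq; apply/andP; split.
  rewrite leqNgt; apply/negP => h; have := before_find 0 h.
  have := leq_trans h (find_size _ _) => h3.
  by rewrite H ?leqnn // -szE.
rewrite leqNgt; apply/negP => h.
have h' : has (fun y => (y == 0) || (a.*2 < y)) s.
  by rewrite has_find (leq_trans h).
have := nth_find 0 h'; rewrite H; first by rewrite leqNgt h.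
by rewrite -szE -has_find.
Qed.

(** The unprimed [b] covers the first [b.+1] of the row, if there is one; the remaining ones are
    then all unprimed, which the marks [b.+1] and [i] record. If the row had no [b], the new one is
    the first and must be on the diagonal. *)
Lemma place_row b i : mixed_tableau n G 0 0 P -> 0 < b <= n ->
  (G b.-1 i = G b i -> G b i = 0) -> (b < n -> G b i < G b.+1 i) ->
  mixed_tableau n (bump_level G b i) b.+1 i (set_shifted_entry P i (i + G b i) b.*2).
Proof.
case: b => [//|b] [hS hE] /= bn first next; split=> [k|a k y an].
  rewrite size_set_shifted_entry /bump_level !hS; case: eqVneq => [->|_]; last first.
    by rewrite andbF addn0.
  rewrite andbT; have [bn'|nb] := ltnP b.+1 n.
    by have := next bn'; have := @G_mono_leq b.+2 n i; rewrite bn' leqnn => /(_ isT); lia.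
  have -> : n = b.+1 by apply/eqP; rewrite eqn_leq bn nb.
  by rewrite eqxx; lia.
rewrite set_shifted_entryE /bump_level; have E := hE a k y an.
case: (eqVneq k i) E => [->|ki] E; last first.
  by rewrite !andbF !addn0 => /E ->; rewrite andbT.
rewrite !andbT; have [ab|nab] := eqVneq a b.
  subst a; rewrite (_ : b == b.+1 = false) ?addn0; last by lia.
  rewrite eqxx addn1 ltnS => /andP[y1]; rewrite leq_eqVlt.
  have [->|yne] := eqVneq y (G b.+1 i) => /=; last first.
    by move=> y2; rewrite E ?y1 //; lia.
  by move=> _; have [e|_] := eqVneq (G b.+1 i) (G b i); [have := first (esym e); lia | rewrite subn0].
have [E1|nab1] := eqVneq a b.+1.
  subst a; rewrite addn1 (_ : b.+2 == b.+1 = false) ?addn0; last by lia.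
  move=> hy; rewrite ?eqxx (_ : y == G b.+1 _ = false) ?andbF /=; last by lia.
  by case/andP: hy => h1 h2; rewrite E ?(ltnW h1) // (gtn_eqF h1).
rewrite (_ : a.+1 == b.+1 = false); last by lia.
rewrite ?addn0 ?andbT ?andbF /=.
move=> hy; rewrite (E hy) andbT; case: eqP => // yE; exfalso.
have [ab|ab] := ltnP a b.
  by have := @G_mono_leq a.+1 b.+1 i; rewrite bn; lia.
have := next; have := @G_mono_leq b.+2 a i; lia.
Qed.

(** Here the row contains no other [b], and the new one is off the diagonal, hence rightly
    primed. *)
Lemma place_column_end b r : mixed_tableau n G b r P -> 0 < b <= n ->
  G b.-1 r = G b r -> 0 < G b r -> (b < n -> G b r < G b.+1 r) ->
  mixed_tableau n (bump_level G b r) b.+1 r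
     (set_shifted_entry P r (r + G b r) b.*2.-1).
Proof.
case: b => [//|b] [hS hE] /= bn empty pos next; split=> [k|a k y an].
  rewrite size_set_shifted_entry /bump_level !hS; case: eqVneq => [->|_]; last first.
    by rewrite andbF addn0.
  rewrite andbT; have [bn'|nb] := ltnP b.+1 n.
    by have := next bn'; have := @G_mono_leq b.+2 n r; rewrite bn' leqnn => /(_ isT); lia.
  have -> : n = b.+1 by apply/eqP; rewrite eqn_leq bn nb.
  by rewrite eqxx; lia.
rewrite set_shifted_entryE /bump_level; have E := hE a k y an.
case: (eqVneq k r) E => [->|ki] E; last first.
  by rewrite !andbF !addn0 => /E ->; rewrite ?andbF ?andbT.
rewrite !andbT; have [ab|nab] := eqVneq a b.
  subst a; rewrite (_ : b == b.+1 = false) ?addn0; last by lia.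
  rewrite eqxx addn1 ltnS => hy; have -> : y = G b.+1 r by lia.
  by rewrite eqxx /= empty eqxx pos; lia.
have [E1|nab1] := eqVneq a b.+1.
  subst a; rewrite addn1 (_ : b.+2 == b.+1 = false) ?addn0; last by lia.
  move=> hy; rewrite ?eqxx (_ : y == G b.+1 _ = false) ?andbF /=; last by lia.
  by case/andP: hy => h1 h2; rewrite E ?(ltnW h1) // (gtn_eqF h1).
rewrite (_ : a.+1 == b.+1 = false); last by lia.
rewrite ?addn0 ?andbT ?andbF /=.
move=> hy; rewrite (E hy) (_ : a.+1 == b.+1 = false) ?andbT; last by lia.
case: eqP => // yE; exfalso.
have [ab|ab] := ltnP a b.
  by have := @G_mono_leq a.+1 b.+1 r; rewrite bn; lia.
have := next; have := @G_mono_leq b.+2 a r; lia.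
Qed.

(** The primed [b] covers the first of the unprimed ones, which restores the normal form of the
    row. *)
Lemma place_column_first b r : mixed_tableau n G b r P -> 0 < b <= n ->
  G b.-1 r < G b r -> 0 < G b.-1 r ->
  mixed_tableau n G 0 0 (set_shifted_entry P r (r + G b.-1 r) b.*2.-1).
Proof.
case: b => [//|b] [hS hE] /= bn nonempty pos; split=> [k|a k y an].
  rewrite size_set_shifted_entry !hS; case: eqVneq => [->|//].
  by have := @G_mono_leq b.+1 n r; rewrite bn leqnn => /(_ isT); lia.
rewrite set_shifted_entryE => hy; rewrite (hE a k y an hy) andbT.
case: (eqVneq k r) hy => [->|_] hy; last by rewrite andbF andbT.
case: eqVneq => [yE|yne] /=; last first.
  have [E|ne] := eqVneq a b; first by subst a; rewrite (negbTE yne).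
  by rewrite ?eqSS ?(negbTE ne) ?andbT.
subst y; have ab : a = b.
  apply/eqP; rewrite eqn_leq; apply/andP; split; rewrite leqNgt; apply/negP => h.
    by have := @G_mono_leq b.+1 a r; lia.
  by have := @G_mono_leq a.+1 b r; lia.
by subst a; rewrite eqxx pos; lia.
Qed.

(** Above row [r] the column meets either the first [b] of a row, which is primed and so not greater
    than the inserted letter, or a smaller letter. *)
Lemma column_find b r : mixed_tableau n G b r P -> 0 < b <= n ->
  0 < G b.-1 r ->
  (forall i, i < r -> G b.-1 i < G b i) ->
  (forall i, i < r -> G b.-1 i.+1 < G b.-1 i) ->
  find (fun y => (y == 0) || (b.*2.-1 < y))
    [seq shifted_entry P i (r + G b.-1 r) | i <- iota 0 (r + G b.-1 r).+1] = r.
Proof.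
move=> hP bn pos strict strict'.
have dec i : i <= r -> G b.-1 r + (r - i) <= G b.-1 i.
  move=> ir; rewrite -(subKn ir); elim: (r - i) (leq_subr i r) => [|d IH] dr.
    by rewrite subn0 subnn addn0.
  have h := IH (ltnW dr); have := strict' (r - d.+1).
  have -> : (r - d.+1).+1 = r - d by lia.
  by rewrite !subKn // in h *; [lia | exact: ltnW].
have bn' : b <= n by case/andP: bn.
apply: find_iota; first by rewrite ltnS leq_addr.
  move=> i ir; rewrite (_ : r + _ = i + (G b.-1 r + (r - i))); last by lia.
  rewrite shifted_entryE; have := dec i (ltnW ir); set y := _ + (r - i) => yG.
  have yn : y < G n i.
    by have := @G_mono_leq b n i; have := strict i ir; rewrite bn' leqnn => ? /(_ isT); lia.
  move: yG; rewrite leq_eqVlt => /orP[/eqP yE|yG].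
    have := hP.2 b.-1 i y; rewrite yE prednK ?leqnn; last by case/andP: bn.
    have y0 : 0 < y by rewrite /y; lia.
    move=> -> //; last exact: strict.
    by rewrite eqxx -yE y0 (ltn_eqF ir) andbF /=; case/andP: bn; lia.
  have := (entry_bounds hP yn (leq_trans (leq_pred b) bn')).1 yG; case/andP: bn; lia.
rewrite shifted_entryE; have [big|yn] := leqP (G n r) (G b.-1 r).
  by rewrite /entry nth_default ?hP.1.
have [yb|yb] := ltnP (G b.-1 r) (G b r).
  have := hP.2 b.-1 r (G b.-1 r); rewrite prednK ?leqnn ?yb; last by case/andP: bn.
  by move=> -> //; rewrite !eqxx !andbF; case/andP: bn; lia.
by have := (entry_bounds hP yn bn').2 yb; lia.
Qed.
End Steps.

Lemma psum_gap f f' n r : (forall i, f i <= f' i) -> r < n ->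
  psum f n + (f' r - f r) <= psum f' n.
Proof.
move=> ff'; elim: n => [//|n IH]; rewrite !psumS ltnS leq_eqVlt.
have le : psum f n <= psum f' n by apply: leq_sum.
case/orP => [/eqP->|/IH]; have := ff' n; first by have := ff' r; lia.
by lia.
Qed.

Lemma bump_row_step f P i v m :
  find (fun y => (y == 0) || (v < y)) (nth [::] P i) = m ->
  mixed_bump f.+1 P true i v =
  let P' := set_shifted_entry P i (i + m) v in
  if entry P i m == 0 then P'
  else if m == 0 then mixed_bump f P' false (i + m).+1 (entry P i m).-1
  else if odd (entry P i m) then mixed_bump f P' false (i + m).+1 (entry P i m)
  else mixed_bump f P' true i.+1 (entry P i m).
Proof. by move=> h; rewrite /= h shifted_entryE (_ : (i == i + m) = (m == 0)) //; lia. Qed.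

Lemma bump_col_step f P j v i m :
  find (fun y => (y == 0) || (v < y)) [seq shifted_entry P k j | k <- iota 0 j.+1] = i ->
  j = i + m ->
  mixed_bump f.+1 P false j v =
  let P' := set_shifted_entry P i (i + m) v in
  if entry P i m == 0 then P'
  else if m == 0 then mixed_bump f P' false (i + m).+1 (entry P i m).-1
  else if odd (entry P i m) then mixed_bump f P' false (i + m).+1 (entry P i m)
  else mixed_bump f P' true i.+1 (entry P i m).
Proof.
move=> h ej; subst j; rewrite {1}/mixed_bump -/mixed_bump h shifted_entryE.
by rewrite (_ : (i == i + m) = (m == 0)) //; lia.
Qed.

Section Insertion.
Variables (n : nat) (g : nat -> nat -> nat) (c : nat -> nat) (x : nat).
Hypothesis G : levels n g c.
Hypothesis xn : 0 < x <= n.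
Hypothesis lat : forall a, 0 < a < n -> incr c x a <= incr c x a.+1.

Let x_pos : 0 < x. Proof. by case/andP: xn. Qed.
Let x_le : x <= n. Proof. by case/andP: xn. Qed.
Let H : levels n (hop g x) (incr c x). Proof. exact: levels_hop. Qed.

(** The state in the middle of an insertion: the levels below [b] already include the new box. *)
Definition mixed_levels (b a : nat) : nat -> nat := if a < b then hop g x a else g a.

Local Notation row b := (hrow g x (b - x)).

Lemma levels_le g' c' a i : levels n g' c' -> a < n -> g' a i <= g' a.+1 i.
Proof. by move=> G' an; have := (levelsI G' an i).2; case: (g' a i) => // k /(_ isT)/ltnW. Qed.

Lemma row_linked b : x <= b < n -> linked (g b) (g b.+1) (row b) (row b.+1).
Proof.
case/andP=> xb bn; have := hrow_linked G x_pos lat (d := b - x).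
by rewrite subSn // subnKC // => /(_ bn).
Qed.

Lemma hop_row b i : x <= b -> hop g x b i = g b i + (i == row b).
Proof. by move=> xb; rewrite /hop xb. Qed.

Lemma row_room b : x <= b < n -> g b (row b) < g b.+1 (row b).
Proof.
case/andP=> xb bn; have := hrow_can_hop G x_pos lat (d := b - x); rewrite subnKC //.
move=> /(_ (ltnW bn)) [_ /(_ bn)]; have := (levelsI G bn (row b)).2.
by case: (g b (row b)) => [_ /(_ isT)|k /(_ isT)].
Qed.

Lemma row_lt b : x <= b <= n -> row b < n.
Proof.
move=> xb; have := hrow_bound G x_pos lat xb.
by case/andP: xb => _; lia.
Qed.

Lemma mixed_levels0 b i : 0 < b -> mixed_levels b 0 i = 0.
Proof. by move=> b0; rewrite /mixed_levels b0 (levels0 H). Qed.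

Lemma mixed_levels_le b a i : x <= b -> a < n -> mixed_levels b a i <= mixed_levels b a.+1 i.
Proof.
move=> xb an; rewrite /mixed_levels; have [ab|ba] := ltnP a.+1 b.
  by rewrite (ltnW ab); exact: (levels_le _ H an).
have [ab|ab] := boolP (a < b); last by exact: (levels_le _ G an).
have {ba ab} E : b = a.+1 by apply/eqP; rewrite eqn_leq ab ba.
have [xa|ax] := leqP x a; last by rewrite hop_below //; exact: (levels_le _ G an).
rewrite hop_row //; have [->|_] := eqVneq i (row a); last first.
  by rewrite addn0; exact: (levels_le _ G an).
by rewrite addn1; apply: row_room; rewrite xa.
Qed.

Lemma bump_mixed_levels b : x <= b -> bump_level (mixed_levels b) b (row b) = mixed_levels b.+1.
Proof.
move=> xb; apply: functional_extensionality => a; apply: functional_extensionality => k.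
rewrite /bump_level /mixed_levels; have [->|ne] := eqVneq a b.
  by rewrite ltnn ltnSn hop_row.
by rewrite (_ : (a < b.+1) = (a < b)) ?addn0 //; lia.
Qed.

Lemma mixed_tableau_done r P : mixed_tableau n (mixed_levels n.+1) n.+1 r P ->
  mixed_tableau n (hop g x) 0 0 P.
Proof.
case=> h1 h2; split=> [i|a i y an].
  by rewrite h1 /mixed_levels ltnSn.
have := h2 a i y an; rewrite /mixed_levels !ltnS an (ltnW an) eqSS.
by rewrite (ltn_eqF an).
Qed.

Lemma column_conditions b : x <= b < n ->
  [/\ 0 < hop g x b (row b),
     forall i, i < row b -> hop g x b i < g b.+1 i &
     forall i, i < row b -> hop g x b i.+1 < hop g x b i].
Proof.
case/andP=> xb bn; have [ch _] : can_hop (g b) (row b) /\ True.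
  by have := hrow_can_hop G x_pos lat (d := b - x); rewrite subnKC // => /(_ (ltnW bn))[-> _].
have pos i : i < row b -> 0 < g b i.
  move: ch; rewrite /can_hop; case: (row b) => // r /= h ir.
  by have := levels_mono G (ltnW bn) (ir : i <= r); lia.
split=> [|i ir|i ir].
- by rewrite hop_row // eqxx addn1.
- rewrite hop_row // (ltn_eqF ir) addn0; exact: (levelsI G bn i).2 (pos i ir).
- have b0 : 0 < b by apply: leq_trans xb.
  have bn' : b.-1 < n by lia.
  have := levelsI H bn' i; rewrite prednK // => -[h1 h2].
  by have := pos i ir; have := @hop_row b i xb; lia.
Qed.

Section Level.
Variable b : nat.
Hypothesis xbn : x <= b <= n.

Let b_pos : 0 < b. Proof. by case/andP: xbn => xb _; apply: leq_trans xb. Qed.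
Let b_le : b <= n. Proof. by case/andP: xbn. Qed.
Let x_le_b : x <= b. Proof. by case/andP: xbn. Qed.
Let M0 i : mixed_levels b 0 i = 0. Proof. exact: mixed_levels0. Qed.
Let Mle a i : a < n -> mixed_levels b a i <= mixed_levels b a.+1 i.
Proof. exact: mixed_levels_le. Qed.
Let Mb : mixed_levels b b = g b. Proof. by rewrite /mixed_levels ltnn. Qed.
Let Mp : mixed_levels b b.-1 = hop g x b.-1.
Proof. by rewrite /mixed_levels prednK ?leqnn. Qed.
Let Ms : mixed_levels b b.+1 = g b.+1.
Proof. by rewrite /mixed_levels ltnNge leqnSn. Qed.

Lemma entry_next b' r' P (r := row b) : mixed_tableau n (mixed_levels b) b' r' P -> b' <= b ->
  entry P r (g b r) = if b < n then b.+1.*2 - (0 < g b r) else 0.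
Proof.
move=> hP b'b; case: ltnP => bn.
  have := hP.2 b r (g b r) bn; rewrite Mb Ms leqnn row_room ?x_le_b // eqxx => -> //.
  by rewrite (_ : b.+1 == b' = false) ?andbT //; lia.
rewrite /entry nth_default ?hP.1 // (_ : n = b) ?Mb //.
by apply/eqP; rewrite eqn_leq bn b_le.
Qed.

(** The letter covered is the first [b.+1] of its row. It goes on primed into the next column in
    every case: off the diagonal it is primed already, and on the diagonal it becomes so. *)
Lemma next_column f Q r y : 
  (if (if b < n then b.+1.*2 - (0 < y) else 0) == 0 then Q
  else if y == 0 then
     mixed_bump f Q false (r + y).+1 (if b < n then b.+1.*2 - (0 < y) else 0).-1
  else if odd (if b < n then b.+1.*2 - (0 < y) else 0) then
     mixed_bump f Q false (r + y).+1 (if b < n then b.+1.*2 - (0 < y) else 0)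
  else mixed_bump f Q true r.+1 (if b < n then b.+1.*2 - (0 < y) else 0)) =
  if b < n then mixed_bump f Q false (r + y.+1) b.+1.*2.-1 else Q.
Proof.
case: (b < n) => //; rewrite addnS; case: y => [|y].
  by rewrite ltnn subn0.
by rewrite ltn0Sn subn1 /= odd_double.
Qed.

Lemma row_mode f P (r := row b) (Q := set_shifted_entry P r (r + g b r) b.*2) :
  mixed_tableau n (mixed_levels b) 0 0 P -> hop g x b.-1 r = g b.-1 r ->
  mixed_tableau n (mixed_levels b.+1) b.+1 r Q /\
  mixed_bump f.+1 P true r b.*2 =
    if b < n then mixed_bump f Q false (r + hop g x b r) b.+1.*2.-1 else Q.
Proof.
move=> hP hr; split.
  rewrite -bump_mixed_levels // /Q -Mb; apply: place_row => //; first by rewrite b_pos.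
    rewrite Mb Mp hr => e; have := levelsI G (a := b.-1); rewrite prednK //.
    by move=> h; have [_] := h b_le r; rewrite e; case: (g b r) => // q /(_ isT); rewrite ltnn.
  by rewrite Mb Ms => bn; apply: row_room; rewrite x_le_b.
have := row_find M0 Mle r hP b_le; rewrite Mb => /(bump_row_step f) ->; cbv zeta.
by rewrite (entry_next hP) // hop_row // eqxx addn1 -/r -/Q next_column.
Qed.

(** The two cases are those of [linked] from level [b.-1] to level [b]: the primed letter finds no
    further [b] in row [r], or it displaces one into the next row. *)
Lemma column_mode f P (r := row b.-1) (y := hop g x b.-1 r)
    (Q := set_shifted_entry P r (r + y) b.*2.-1) :
  x < b -> mixed_tableau n (mixed_levels b) b r P ->
  [/\ row b = r, g b r = y, mixed_tableau n (mixed_levels b.+1) b.+1 r Q &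
      mixed_bump f.+1 P false (r + y) b.*2.-1 =
      if b < n then mixed_bump f Q false (r + hop g x b r) b.+1.*2.-1 else Q] \/
  [/\ row b = r.+1, y < g b r, mixed_tableau n (mixed_levels b) 0 0 Q &
      mixed_bump f.+1 P false (r + y) b.*2.-1 = mixed_bump f Q true r.+1 b.*2].
Proof.
move=> xb hP; have xb' : x <= b.-1 < n by lia.
have [c1 c2 c3] := column_conditions xb'; rewrite prednK // in c2.
have lk := row_linked xb'; rewrite prednK // in lk.
have yE : y = (g b.-1 r).+1 by rewrite /y hop_row ?eqxx ?addn1 //; lia.
have bn : 0 < b <= n by rewrite b_pos.
have : find (fun z => (z == 0) || (b.*2.-1 < z))
    [seq shifted_entry P k (r + y) | k <- iota 0 (r + y).+1] = r.
  have := column_find M0 Mle hP bn; rewrite Mp Mb; exact.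
move=> /(bump_col_step f)/(_ erefl) ->; cbv zeta.
case: lk => -[l1 l2]; [left|right].
  have gy : g b r = y by rewrite l1 -yE.
  split=> //.
    rewrite -bump_mixed_levels // l2 -/r /Q -gy -Mb.
    apply: place_column_end; rewrite ?Mp ?Mb ?Ms //; first by rewrite gy.
    by move=> bn'; have := @row_room b; rewrite l2 x_le_b; apply.
  have := entry_next hP (leqnn b); rewrite l2 -/r gy => ->.
  by rewrite -/Q next_column hop_row // l2 eqxx addn1 gy.
have yb : y < g b r by rewrite yE.
have E : entry P r y = b.*2.
  have := hP.2 b.-1 r y; rewrite prednK // Mp Mb leqnn yb => -> //; last by lia.
split=> //.
  have := place_column_first Mle hP bn.
  by rewrite Mp Mb; apply; lia.
by rewrite E double_eq0 (gtn_eqF b_pos) odd_double (_ : (y == 0) = false) // yE.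
Qed.

End Level.

(** Fuel is measured against the number of letters not yet treated. Level [b] costs two bumps, one
    in a column and one in a row, only when the row concerned has at least two letters [b], and
    [gap] pays for both. *)
Lemma bump_loop k b : b + k = n -> x <= b ->
  (forall fuel P, psum (g n) n < fuel + psum (g b) n ->
     hop g x b.-1 (row b) = g b.-1 (row b) ->
     mixed_tableau n (mixed_levels b) 0 0 P ->
     mixed_tableau n (hop g x) 0 0 (mixed_bump fuel P true (row b) b.*2)) /\
  (forall fuel P, x < b -> psum (g n) n <= fuel + psum (g b.-1) n ->
     mixed_tableau n (mixed_levels b) b (row b.-1) P ->
     mixed_tableau n (hop g x) 0 0
       (mixed_bump fuel P false (row b.-1 + hop g x b.-1 (row b.-1)) b.*2.-1)).
Proof.
have le a : a < n -> psum (g a) n <= psum (g a.+1) n.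
  by move=> an; apply: leq_sum => i _; apply: (levels_le _ G an).
have le_n a : a <= n -> psum (g a) n <= psum (g n) n.
  have up j : a + j <= n -> psum (g a) n <= psum (g (a + j)) n.
    elim: j => [|j IHj]; rewrite ?addn0 // addnS => aj.
    exact: leq_trans (IHj (ltnW aj)) (le _ aj).
  by move=> an; have := up (n - a); rewrite subnKC //; apply.
have gap a : x <= a < n ->
    psum (g a) n + (g a.+1 (row a) - g a (row a)) <= psum (g a.+1) n.
  move=> xa; apply: psum_gap; last by apply: row_lt; lia.
  by move=> i; apply: (levels_le _ G); lia.
have step j b' : b' + j = n -> x <= b' -> (b' < n ->
   forall fuel P, psum (g n) n <= fuel + psum (g b') n ->
     mixed_tableau n (mixed_levels b'.+1) b'.+1 (row b') P ->
     mixed_tableau n (hop g x) 0 0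
       (mixed_bump fuel P false (row b' + hop g x b' (row b')) b'.+1.*2.-1)) ->
  (forall fuel P, psum (g n) n < fuel + psum (g b') n ->
     hop g x b'.-1 (row b') = g b'.-1 (row b') ->
     mixed_tableau n (mixed_levels b') 0 0 P ->
     mixed_tableau n (hop g x) 0 0 (mixed_bump fuel P true (row b') b'.*2)) /\
  (forall fuel P, x < b' -> psum (g n) n <= fuel + psum (g b'.-1) n ->
     mixed_tableau n (mixed_levels b') b' (row b'.-1) P ->
     mixed_tableau n (hop g x) 0 0
       (mixed_bump fuel P false (row b'.-1 + hop g x b'.-1 (row b'.-1)) b'.*2.-1)).
  move=> bj xb Cn; have xbn : x <= b' <= n by lia.
  have bn : b' <= n by lia.
  have fin P : n <= b' -> mixed_tableau n (mixed_levels b'.+1) b'.+1 (row b') P ->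
      mixed_tableau n (hop g x) 0 0 P.
    move=> nb; have -> : b' = n by lia.
    exact: mixed_tableau_done.
  have R fuel P : psum (g n) n < fuel + psum (g b') n ->
     hop g x b'.-1 (row b') = g b'.-1 (row b') ->
     mixed_tableau n (mixed_levels b') 0 0 P ->
     mixed_tableau n (hop g x) 0 0 (mixed_bump fuel P true (row b') b'.*2).
    case: fuel => [|f] hf hr hP; first by have := le_n b' bn; lia.
    have [hQ ->] := row_mode xbn f hP hr; case: ltnP => [b'n|nb]; last exact: fin hQ.
    by apply: (Cn b'n) => //; lia.
  split=> // fuel P xb' hf hP.
  have xb1 : x <= b'.-1 < n by lia.
  have := gap _ xb1; rewrite prednK; last by lia.
  have yE : hop g x b'.-1 (row b'.-1) = (g b'.-1 (row b'.-1)).+1.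
    by rewrite hop_row ?eqxx ?addn1 //; lia.
  case: fuel hf => [|f] hf gp.
    have := le_n b' bn; have := row_room xb1; rewrite prednK; last by lia.
    by lia.
  case: (column_mode xbn f xb' hP) => -[h1 h2 hQ ->].
    rewrite -{1}h1 in hQ.
    case: ltnP => [b'n|nb]; last exact: fin hQ.
    have := Cn b'n f _ _ hQ; rewrite h1; apply; lia.
  rewrite -h1; apply: R => //; first by lia.
  rewrite h1 hop_row; last by lia.
  by rewrite gtn_eqF // addn0.
elim: k b => [|k IH] b bk xb.
  by apply: (step 0) => // bn; lia.
apply: (step k.+1) => // bn; have [||_] := IH b.+1; rewrite ?addSnnS //.
  exact: ltnW.
by move=> h fuel P h1 h2; apply: h.
Qed.

Lemma mixed_insert_spec P : mixed_tableau n g 0 0 P ->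
  mixed_tableau n (hop g x) 0 0 (mixed_insert P x).
Proof.
move=> hP; have [R _] := @bump_loop (n - x) x (subnKC x_le) (leqnn x).
have row0 : row x = 0 by rewrite subnn.
have := R (sumn (shape P)).+1 P; rewrite row0; apply.
- suff -> : sumn (shape P) = psum (g n) n by lia.
  rewrite (@psum_tail (g n) (size P) n); last 2 first.
  + by move=> l lP; rewrite -(hP.1 l) nth_default.
  + by move=> l nl; apply: (levels_rows G).
  rewrite /psum sumnE /shape big_map (big_nth [::]) big_mkord.
  by apply: eq_bigr => l _; rewrite hP.1.
- by rewrite hop_below // ltn_predL.
- have -> : mixed_levels x = g; last exact: hP.
  apply: functional_extensionality => a; rewrite /mixed_levels.
  by case: ltnP => // /hop_below ->.
Qed.
End Insertion.

Lemma foldl_mixed_insert n g c w P : levels n g c -> lattice n c w ->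
  mixed_tableau n g 0 0 P ->
  mixed_tableau n (foldl hop g w) 0 0 (foldl mixed_insert P w).
Proof.
elim: w g c P => [//|x w IH] g c P G /lattice_step[xn lat lw] hP.
apply: (IH _ _ _ _ lw); last exact: mixed_insert_spec G xn lat _ hP.
by case/andP: xn => x0 xn; apply: levels_hop.
Qed.

Lemma size_mixed_P n w i : lattice n (fun _ => 0) w ->
  size (nth [::] (mixed_P w) i) = foldl hop (fun _ _ => 0) w n i.
Proof.
move=> lw; have [|h _] := foldl_mixed_insert (P := [::]) (levels_init n) lw; last exact: h.
by split=> [k|a k y _]; rewrite ?nth_nil // andbC ltn0.
Qed.

Lemma lattice_cat n c w1 w2 : lattice n c (w1 ++ w2) = lattice n c w1 && lattice n (addw c w1) w2.
Proof.
elim: w1 c => [|x w1 IH] c /=; first by rewrite addw_nil.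
by rewrite IH addw_cons !andbA.
Qed.

Lemma size_rboxes L rs : size (rboxes L rs) = size rs.
Proof. by elim: rs L => [//|r rs IH] L /=; rewrite IH. Qed.

Lemma take_rboxes k L rs : take k (rboxes L rs) = rboxes L (take k rs).
Proof. by elim: rs k L => [|r rs IH] [|k] L //=; rewrite IH. Qed.

Lemma take_hrows n k g w : take k (hrows n g w) = hrows n g (take k w).
Proof. by elim: w k g => [|x w IH] [|k] g //=; rewrite IH. Qed.

Lemma mem_rboxes L rs i j :
  ((i, j) \in rboxes L rs) = (i <= j) && (L i <= j - i < addw L rs i).
Proof.
elim: rs L => [|r rs IH] L /=; first by rewrite addw_nil in_nil; lia.
rewrite inE IH addw_cons xpair_eqE /incr /addw.
have [->|ne] := eqVneq i r; last by lia.
by case: (leqP r j) => rj; lia.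
Qed.

(* If the k-th insertion tableau consists of the first k boxes, then the
   recording tableau numbers the boxes in this order. *)
Lemma recording_fill box bs :
  (forall k i j, k <= size bs -> box k i j = ((i, j) \in take k bs)) ->
  recording box (size bs) = fill bs.
Proof.
move=> h; apply: filling_ext => i j; rewrite /recording /fill.
set N := size bs.
have [mem|nmem] := boolP ((i, j) \in bs); last first.
  rewrite (_ : find _ _ = N.+1) ?ltnn //.
  rewrite -[RHS](size_iota 0); apply: hasNfind; apply/hasPn => k.
  rewrite mem_iota /= => kN; rewrite h //.
  by apply: contra nmem => /mem_take.
have p : index (i, j) bs < N by rewrite index_mem.
rewrite -[iota _ _](map_id) (find_iota (r := (index (i, j) bs).+1)) //.
- by rewrite p.
- move=> k; rewrite ltnS => kp; rewrite h; last exact: leq_trans kp (ltnW p).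
  by rewrite in_take // ltnNge kp.
- by rewrite h // in_take.
Qed.

Lemma mixed_Q_fill n w : lattice n (fun _ => 0) w ->
  mixed_Q w = fill (rboxes (fun _ => 0) (hrows n (fun _ _ => 0) w)).
Proof.
move=> lw; have sz : size (rboxes (fun _ => 0) (hrows n (fun _ _ => 0) w)) = size w.
  by rewrite size_rboxes size_hrows.
rewrite /mixed_Q -sz; apply: recording_fill => k i j _.
have lk : lattice n (fun _ => 0) (take k w).
  by move: lw; rewrite -{1}(cat_take_drop k w) lattice_cat => /andP[].
rewrite (size_mixed_P _ lk) (hrows_end _ lk).
by rewrite take_rboxes take_hrows mem_rboxes.
Qed.

(** * Row insertion *)

Lemma find_threshold (p : pred nat) s m : m <= size s ->
  (forall y, y < size s -> p (nth 0 s y) = (m <= y)) -> find p s = m.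
Proof.
move=> ms h; apply/eqP; rewrite eqn_leq; apply/andP; split.
  rewrite leqNgt; apply/negP => lt; have := before_find 0 lt.
  by rewrite h ?leqnn // (leq_trans lt) // find_size.
rewrite leqNgt; apply/negP => lt; have hp : has p s by rewrite has_find (leq_trans lt).
by have := nth_find 0 hp; rewrite h -?has_find // leqNgt lt.
Qed.

(* the number of letters <= a in row i of the insertion tableau: row i contains the
   letters a - i as the entries a *)
Definition rsk_level (c : nat -> nat) (a i : nat) : nat := if i < a then c (a - i) else 0.

Definition rsk_tableau (n : nat) (c : nat -> nat) (i : nat) (P : tableau) : Prop :=
  (forall k, size (nth [::] P k) = rsk_level c n (i + k)) /\
  (forall a k y, a < n -> rsk_level c a (i + k) <= y < rsk_level c a.+1 (i + k) ->
     entry P k y = a.+1).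

Section Insert.
Variables (n : nat) (c : nat -> nat) (x : nat).
Hypothesis xn : 0 < x <= n.
Hypothesis lat0 : forall a, 0 < a < n -> c a <= c a.+1.
Hypothesis lat : forall a, 0 < a < n -> incr c x a <= incr c x a.+1.

Let R0 i : rsk_level c 0 i = 0. Proof. by []. Qed.
Let Rle a i : a < n -> rsk_level c a i <= rsk_level c a.+1 i.
Proof.
move=> an; rewrite /rsk_level; case: ltnP => // ia; rewrite ltnS (ltnW ia).
by rewrite subSn ?(ltnW ia) //; apply: lat0; lia.
Qed.

Lemma rsk_find i r P a : rsk_tableau n c i (r :: P) -> a <= n ->
  find (fun y => a < y) r = rsk_level c a i.
Proof.
move=> [hS hE] an; have hr := hS 0; rewrite addn0 /= in hr.
apply: find_threshold; rewrite hr.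
  by apply: (G_mono_leq Rle); rewrite an leqnn.
move=> y yn; have [k kn hk] := level_of R0 yn.
have := hE k 0 y kn; rewrite addn0 => /(_ hk); rewrite /entry /= => ->; rewrite ltnS.
apply/idP/idP => [ak|ay].
  have := @G_mono_leq n (rsk_level c) Rle a k i; rewrite ak (ltnW kn) => /(_ isT); lia.
rewrite leqNgt; apply/negP => ka; have := @G_mono_leq n (rsk_level c) Rle k.+1 a i.
by rewrite ka an => /(_ isT); lia.
Qed.

Lemma rsk_level_incr a i : rsk_level (incr c x) a i = rsk_level c a i + ((i < a) && (a - i == x)).
Proof. by rewrite /rsk_level /incr; case: ifP. Qed.

Lemma rsk_row_set a i r : x + i = a -> a <= n -> size r = rsk_level c n i ->
  (a < n -> c x < rsk_level c a.+1 i) ->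
  (forall a' y, a' < n -> rsk_level c a' i <= y < rsk_level c a'.+1 i -> nth 0 r y = a'.+1) ->
  let r' := set_nth 0 r (c x) a in
  size r' = rsk_level (incr c x) n i /\
  (forall a' y, a' < n ->
     rsk_level (incr c x) a' i <= y < rsk_level (incr c x) a'.+1 i -> nth 0 r' y = a'.+1).
Proof.
move=> xi an hS next hE /=; have x0 : 0 < x by case/andP: xn.
have Ra : rsk_level c a i = c x by rewrite /rsk_level -xi addnK; case: ltnP => //; lia.
have on a' : (i < a') && (a' - i == x) = (a' == a) by lia.
split=> [|a' y a'n]; rewrite !rsk_level_incr !on.
  rewrite size_set_nth hS; have [nb|an'] := leqP n a.
    by have E : n = a by [lia]; rewrite E eqxx Ra; lia.
  have := next an'; have := @G_mono_leq n (rsk_level c) Rle a.+1 n i.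
  by rewrite an' leqnn => /(_ isT); lia.
rewrite nth_set_nth /=; have [yE|yne] := eqVneq y (c x); last first.
  move=> hy; apply: hE => //; move: hy.
  have [E|_] := eqVneq a' a; first by rewrite E Ra; lia.
  by have [E|_] := eqVneq a'.+1 a; [rewrite E Ra; lia | lia].
subst y; have [E|ne] := eqVneq a' a; first by subst a'; rewrite Ra; lia.
have [E|ne'] := eqVneq a'.+1 a => // hy; exfalso.
have [lt|lt] := ltnP a' a.
  have := @G_mono_leq n (rsk_level c) Rle a'.+1 a i; rewrite an andbT => /(_ lt).
  by lia.
have an' : a < n by lia.
have := next an'; have := @G_mono_leq n (rsk_level c) Rle a.+1 a' i.
by rewrite (ltnW a'n) andbT ltn_neqAle eq_sym ne lt => /(_ isT); lia.
Qed.

(** The letter [a] inserted into row [i] bumps an [a.+1], which is present because the lattice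
    condition makes [x.+1] more frequent than [x]. The chain ends with [n], appended to row
    [n - x]. *)
Lemma row_insert_spec d a i P : a + d = n -> x + i = a -> rsk_tableau n c i P ->
  rsk_tableau n (incr c x) i (row_insert P a).
Proof.
have x0 : 0 < x by case/andP: xn.
have glue r P' j : size r = rsk_level (incr c x) n j ->
   (forall a' y, a' < n -> rsk_level (incr c x) a' j <= y < rsk_level (incr c x) a'.+1 j ->
     nth 0 r y = a'.+1) -> rsk_tableau n (incr c x) j.+1 P' ->
   rsk_tableau n (incr c x) j (r :: P').
  move=> h1 h2 [h3 h4]; split=> [[|k]|a' [|k] y a'n].
  - by rewrite addn0.
  - by rewrite /= h3 addnS addSn.
  - by rewrite addn0; apply: h2.
  - by rewrite addnS -addSn; apply: h4.
have same j P' : n < x + j -> rsk_tableau n c j P' -> rsk_tableau n (incr c x) j P'.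
  have E k a' : a' <= n -> n < x + j -> rsk_level (incr c x) a' (j + k) = rsk_level c a' (j + k).
    by move=> a'n xj; rewrite rsk_level_incr; lia.
  move=> xj [h1 h2]; split=> [k|a' k y a'n]; first by rewrite h1 E.
  by rewrite !E //; [apply: h2 | apply: ltnW].
elim: d a i P => [|d IH] a i P ad xi hP.
all: have an : a <= n by lia.
all: have Ra : rsk_level c a i = c x by rewrite /rsk_level -xi addnK; case: ltnP => //; lia.
  have {ad} E : a = n by lia.
  rewrite {}E in an Ra xi hP *; case: P hP => [|r P] hP.
    have s0 : c x = 0 by have := hP.1 0; rewrite addn0 Ra.
    have := @rsk_row_set n i [::] xi (leqnn n); rewrite Ra s0 ltnn => -[]//.
      move=> a' y a'n; have := @G_mono_leq n (rsk_level c) Rle a'.+1 n i.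
      by rewrite a'n leqnn Ra s0 => /(_ isT); lia.
    move=> h1 h2; apply: glue => //; apply: same; first by lia.
    split=> [k|a' k y a'n]; have := hP.1 k.+1; rewrite nth_nil /= => e.
      by rewrite nth_nil /= addSnnS -e.
    have := @G_mono_leq n (rsk_level c) Rle a'.+1 n (i.+1 + k).
    by rewrite a'n leqnn addSn -addnS -e => /(_ isT); lia.
  have hS := hP.1 0; rewrite addn0 /= in hS.
  rewrite [row_insert _ _]/= (rsk_find hP (leqnn n)) hS ltnn.
  have tl : rsk_tableau n c i.+1 P.
    case: hP => h1 h2; split=> [k|a' k y a'n]; first by have := h1 k.+1; rewrite addnS.
    by have := h2 a' k.+1 y a'n; rewrite addnS.
  have := @rsk_row_set n i r xi (leqnn n) hS; rewrite ltnn => -[]//.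
    by move=> a' y a'n; have := hP.2 a' 0 y a'n; rewrite addn0.
  rewrite set_nthE hS Ra ltnn subnn /= cats1 => h1 h2.
  by apply: glue => //; apply: same tl; lia.
have an' : a < n by lia.
have Rx : c x < rsk_level c a.+1 i.
  have := lat (a := x); rewrite /rsk_level ltnS.
  have -> : a.+1 - i = x.+1 by lia.
  by rewrite (_ : i <= a) /incr; lia.
have Rn : rsk_level c a.+1 i <= rsk_level c n i.
  by apply: (@G_mono_leq n (rsk_level c) Rle); rewrite an' leqnn.
have hS := hP.1 0; rewrite addn0 in hS.
case: P hP hS => [|r P] hP hS; first by move: hS => /=; lia.
rewrite /= in hS.
have tl : rsk_tableau n c i.+1 P.
  case: hP => h1 h2; split=> [k|a' k y a'n]; first by have := h1 k.+1; rewrite addnS.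
  by have := h2 a' k.+1 y a'n; rewrite addnS.
have hE a' y : a' < n -> rsk_level c a' i <= y < rsk_level c a'.+1 i -> nth 0 r y = a'.+1.
  by move=> a'n; have := hP.2 a' 0 y a'n; rewrite addn0.
rewrite [row_insert _ _]/= (rsk_find hP an) hS Ra (leq_trans Rx Rn).
rewrite (hE a (c x)) ?Ra ?leqnn //.
have [//|h1 h2] := rsk_row_set xi an hS _ hE.
by apply: (glue _ _ _ h1 h2); apply: IH; [lia | lia | exact: tl].
Qed.
End Insert.

Lemma foldl_row_insert n c w P : lattice n c w -> (forall a, 0 < a < n -> c a <= c a.+1) ->
  rsk_tableau n c 0 P -> rsk_tableau n (addw c w) 0 (foldl row_insert P w).
Proof.
elim: w c P => [|x w IH] c P; first by rewrite addw_nil.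
move=> /lattice_step[xn lat lw] lat0 hP; rewrite addw_cons; apply: IH => //.
have /andP[_ xn'] := xn.
by apply: (row_insert_spec xn lat0 lat (d := n - x)); rewrite ?subnKC ?addn0.
Qed.

Lemma size_RSK_P n w i : lattice n (fun _ => 0) w ->
  size (nth [::] (RSK_P w) i) = if i < n then count_mem (n - i) w else 0.
Proof.
move=> lw; have [//||h _] := foldl_row_insert (P := [::]) lw.
  by split=> [k|a k y _]; rewrite ?nth_nil /rsk_level ?if_same // ltn0 andbF.
by rewrite h add0n.
Qed.

Lemma size_sqboxes n c w : size (sqboxes n c w) = size w.
Proof. by elim: w c => [//|x w IH] c /=; rewrite IH. Qed.

Lemma take_sqboxes n k c w : take k (sqboxes n c w) = sqboxes n c (take k w).
Proof. by elim: w k c => [|x w IH] [|k] c //=; rewrite IH. Qed.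

Lemma mem_sqboxes n c w i j : all (fun x => 0 < x <= n) w ->
  ((i, j) \in sqboxes n c w) = (i < n) && (c (n - i) <= j < addw c w (n - i)).
Proof.
elim: w c => [|x w IH] c /=; first by rewrite addw_nil in_nil; lia.
move=> /andP[xn hw]; rewrite inE IH // addw_cons xpair_eqE /incr /addw.
have [->|ne] := eqVneq i (n - x); last first.
  by rewrite (_ : (n - i == x) = false) ?addn0 //; lia.
by rewrite subKn ?eqxx; lia.
Qed.

Lemma lattice_letters n c w : lattice n c w -> all (fun x => 0 < x <= n) w.
Proof. by elim: w c => [|x w IH] c /=; [|move=> /and3P[-> _ /IH]]. Qed.

Lemma RSK_Q_fill n w : lattice n (fun _ => 0) w ->
  RSK_Q w = fill (sqboxes n (fun _ => 0) w).
Proof.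
move=> lw; rewrite /RSK_Q -(size_sqboxes n (fun _ => 0)); apply: recording_fill => k i j _.
have lk : lattice n (fun _ => 0) (take k w).
  by move: lw; rewrite -{1}(cat_take_drop k w) lattice_cat => /andP[].
rewrite (size_RSK_P _ lk) take_sqboxes mem_sqboxes; last exact: lattice_letters lk.
by case: ifP.
Qed.

(** * Crystal operators and promotion *)

(* The empty box is in the row of the letter a, and d counts the letters of the
   output.  The final letter is the row where the path ends. *)
Fixpoint scan (a : nat) (d : nat -> nat) (w : seq nat) : seq nat :=
  if w is x :: w' then
    if (x == a) || ((x.+1 == a) && (d x == d a)) then a :: scan x (incr d a) w'
    else x :: scan a (incr d x) w'
  else [:: a].

(** The letter [a] is in transit: [d] counts the output, [incr d a] the letters read, and the
    lattice condition holds for both. *)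
Record active (n a : nat) (d : nat -> nat) (w : seq nat) : Prop := Active {
  active_range : 0 < a <= n;
  active_before : forall b, 0 < b < n -> d b <= d b.+1;
  active_after : forall b, 0 < b < n -> incr d a b <= incr d a b.+1;
  active_lattice : lattice n (incr d a) w }.

Lemma incrC d a b : incr (incr d a) b = incr (incr d b) a.
Proof. by apply: functional_extensionality => z; rewrite /incr addnAC. Qed.

Lemma active_step n a d x w : active n a d (x :: w) ->
  if (x == a) || ((x.+1 == a) && (d x == d a)) then active n x (incr d a) w
  else active n a (incr d x) w.
Proof.
move=> [an h1 h2 /lattice_step[xn h3 lw]]; case: ifP => h; first by split.
rewrite incrC in h3 lw; split=> // b bn; have := h1 b bn; have := h3 b bn.
move: h; rewrite /incr; have [E|ne] := eqVneq b.+1 a; last by lia.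
by rewrite -E; have [->|] := eqVneq b x; lia.
Qed.

Lemma promote_scan n a d w : active n a d w ->
  promote_boxes (n - a, d a) (sqboxes n (incr d a) w) = sqboxes n d (scan a d w).
Proof.
elim: w a d => [//|x w IH] a d G; have := active_step G.
have [an h1 h2 /lattice_step[xn h3 lw]] := G.
rewrite [sqboxes n _ (x :: w)]/= promote_boxes_cons.
have -> : next_to (n - a, d a) (n - x, incr d a x) =
    (x == a) || ((x.+1 == a) && (d x == d a)).
  rewrite /next_to !xpair_eqE /incr /=; have [->|ne] := eqVneq x a; last by lia.
  by rewrite eqxx addn1 eqxx.
rewrite [scan _ _ _]/=; case: ifP => [_|ne] /IH; rewrite [sqboxes n d _]/=; first by move<-.
rewrite incrC => <-; have {}ne : x == a = false by move: ne; case: (x == a).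
by rewrite /incr ne [a == x]eq_sym ne !addn0.
Qed.

Lemma scan_perm a d w : perm_eq (a :: w) (scan a d w).
Proof.
elim: w a d => [//|x w IH] a d /=; case: ifP => _; first by rewrite perm_cons.
have /perm_trans : perm_eq [:: a, x & w] [:: x, a & w] by apply/permP => q /=; lia.
by apply; rewrite perm_cons.
Qed.

Lemma scan_lattice n a d w : active n a d w -> lattice n d (scan a d w).
Proof.
have allI f : (forall b, 0 < b < n -> f b <= f b.+1) -> all (fun b => f b <= f b.+1) (iota 1 n.-1).
  by move=> h; apply/allP => b; rewrite mem_iota => bn; apply: h; lia.
elim: w a d => [|x w IH] a d G; have [an h1 h2 lw] := G.
  by rewrite /= an allI.
have := active_step G; have [xn _ _] := lattice_step lw.
by rewrite [scan _ _ _]/=; case: ifP => _ G' /=; rewrite IH // ?an ?xn /= andbT allI //;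
  apply: active_before G'.
Qed.

Lemma unpaired_cat (j pos dp : nat) (v1 v2 : seq nat) :
  (forall i, count_mem j (take i v1) <= dp + count_mem j.+1 (take i v1)) ->
  unpaired j pos dp (v1 ++ v2) =
  unpaired j (pos + size v1) (dp + count_mem j.+1 v1 - count_mem j v1) v2.
Proof.
elim: v1 pos dp => [|x v1 IH] pos dp h /=; first by rewrite addn0 addn0 subn0.
have hS i := h i.+1; rewrite /= in hS.
have [E|ne] := eqVneq x j.+1.
  have ej : (x == j) = false by lia.
  rewrite IH => [|i]; last by have := hS i; rewrite ej E eqxx add0n add1n addnS addSn.
  by rewrite ej add0n add1n !addnS !addSn.
have [E|ne'] := eqVneq x j.
  have := hS 0; rewrite take0 (negbTE ne) E eqxx /=.
  case: dp h hS => [|dp] h hS _; first by have := hS 0; rewrite take0 (negbTE ne) E eqxx.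
  rewrite IH => [|i]; last by have := hS i; rewrite (negbTE ne) E eqxx !add0n add1n addSn ltnS.
  by rewrite add0n add1n !addnS !addSn subSS.
rewrite IH => [|i]; last by have := hS i; rewrite (negbTE ne) (negbTE ne').
by congr unpaired; lia.
Qed.

(** The letters [j] and [j.+1] of [v1] are completely paired, and each [j] of [v2] is paired within
    [v2]; so the [j] between them is the only unpaired one. *)
Lemma crystal_e_spec (j : nat) (v1 v2 : seq nat) :
  (forall i, count_mem j (take i v1) <= count_mem j.+1 (take i v1)) ->
  count_mem j v1 = count_mem j.+1 v1 ->
  (forall i, count_mem j (take i v2) <= count_mem j.+1 (take i v2)) ->
  crystal_e j (v1 ++ j :: v2) = Some (v1 ++ j.+1 :: v2).
Proof.
move=> h1 e h2; rewrite /crystal_e unpaired_cat // e subnn /=.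
rewrite (_ : j == j.+1 = false) ?eqxx; last by lia.
rewrite -[v2 in unpaired _ _ _ v2]cats0 unpaired_cat //=; congr Some.
elim: v1 {h1 e} => [//|y v1 IH] /=; by congr cons.
Qed.

Lemma lattice_prefix n c w j i : lattice n c w -> 0 < j < n -> c j <= c j.+1 ->
  c j + count_mem j (take i w) <= c j.+1 + count_mem j.+1 (take i w).
Proof.
elim: w c i => [|x w IH] c i; first by rewrite /= !addn0.
move=> /lattice_step[_ h lw] jn cj; case: i => [|i]; first by rewrite /= !addn0.
by have := IH _ i lw jn (h j jn); rewrite /incr /= !addnA !(eq_sym x).
Qed.

Lemma addw_rcons c w x : addw c (rcons w x) = incr (addw c w) x.
Proof.
apply: functional_extensionality => y.
by rewrite /addw /incr -cats1 count_cat /= addn0 addnA (eq_sym x).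
Qed.

(** The prefix [pre] is output already. The operators act in order of decreasing index, the order in
    which the path leaves the rows of the letters, so each of them changes the letter at the next
    descent. *)
Lemma scan_crystal n a pre w (d := addw (fun _ => 0) pre) :
  lattice n (fun _ => 0) pre -> active n a d w ->
  (forall b, 0 < b <= n -> addw (incr d a) w b = n) ->
  exists2 u, scan a d w = rcons u 1 &
    foldr (fun j v => obind (crystal_e j) v) (Some (pre ++ w)) (iota 1 a.-1) = Some (pre ++ u).
Proof.
rewrite {}/d; elim: w a pre => [|x w IH] a pre lp G hn.
  have [an h _ _] := G; exists [::] => /=.
    (* At the end all rows are full. For [a > 1] the output would contain [n] letters [a.-1] but
       only [n.-1] letters [a], against the lattice condition; so the path ends in the row of 1. *)
    congr cons; have [//|a1] := leqP a 1; first by lia.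
    have := h a.-1; have := hn a.-1; have := hn a; rewrite addw_nil /incr eqxx prednK; last by lia.
    by lia.
  have [a1|a1] := leqP a 1; first by (have -> : a = 1 by lia).
  have := h a.-1; have := hn a.-1; have := hn a; rewrite addw_nil /incr eqxx prednK; last by lia.
  by lia.
have := active_step G; have [an h1 h2 lw] := G; have [xn h3 lw'] := lattice_step lw.
rewrite [scan _ _ _]/=; set dd := addw _ pre in G h1 h2 lw h3 lw' *.
case: ifP => h G'.
  have lp' : lattice n (fun _ => 0) (rcons pre a).
    rewrite -cats1 lattice_cat lp /= an andbT.
    by apply/allP => b; rewrite mem_iota => bn; apply: h2; lia.
  have := IH x (rcons pre a) lp'; rewrite addw_rcons -/dd => /(_ G')[|u -> hu].
    by move=> b bn; rewrite -addw_cons hn.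
  exists (a :: u) => //; rewrite !cat_rcons in hu; case/orP: h => [/eqP E|].
    by move: hu; rewrite E.
  case/andP => /eqP E /eqP dE; have xn' : 0 < x < n by lia.
  have C : crystal_e x (pre ++ x :: w) = Some (pre ++ x.+1 :: w).
    apply: crystal_e_spec => [i||i].
    - by have := lattice_prefix i lp xn' (leq0n _); rewrite !add0n.
    - by move: dE; rewrite -E /dd /addw !add0n.
    have := lattice_prefix i lw' xn' (h3 x xn').
    by rewrite /incr E !eqxx dE -E ltn_eqF ?gtn_eqF // !addn0 leq_add2l.
  have x0 : 0 < x by case/andP: xn'.
  (* The last index in [iota 1 a.-1] is [x], and [foldr] applies its operator first. *)
  have -> : a.-1 = x.-1 + 1 by rewrite -E addn1 prednK.
  by rewrite iotaD foldr_cat /= add1n prednK // C /= E.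
have lp' : lattice n (fun _ => 0) (rcons pre x).
  rewrite -cats1 lattice_cat lp /= xn andbT.
  by apply/allP => b; rewrite mem_iota => bn; apply: (active_before G'); lia.
have := IH a (rcons pre x) lp'; rewrite addw_rcons -/dd => /(_ G')[|u -> hu].
  by move=> b bn; rewrite incrC -addw_cons hn.
by exists (x :: u) => //; rewrite -!cat_rcons.
Qed.

Lemma next_to_shift n p q : next_to (shift_box n p) (shift_box n q) = next_to p q.
Proof. by rewrite /next_to !xpair_eqE /= -addSn !eqn_add2r. Qed.

Lemma promote_boxes_shift n p bs :
  promote_boxes (shift_box n p) (map (shift_box n) bs) = map (shift_box n) (promote_boxes p bs).
Proof.
elim: bs p => [//|b bs IH] p; rewrite [map _ (b :: _)]/= !promote_boxes_cons next_to_shift.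
by case: ifP => _ /=; rewrite IH.
Qed.

Lemma linear_shift n bs : linear (map (shift_box n) bs) = linear bs.
Proof.
rewrite /linear map_inj_uniq ?pairwise_map; last exact: shift_box_inj.
by congr andb; apply: eq_pairwise => p q; rewrite /= next_to_shift.
Qed.

Lemma boxes_inj m s t : boxes m s = boxes m t -> s = t.
Proof.
elim: s m t => [|x s IH] m [|y t] //= [e1]; rewrite e1 => /addnI <- e.
by rewrite (IH _ _ e).
Qed.

(** * Promotion of Q(w) and of its rectification *)

Definition full (n : nat) (w : seq nat) : Prop :=
  [/\ size w = n ^ 2, lattice n (fun _ => 0) w & forall a, 0 < a <= n -> count_mem a w = n].

Lemma full_head n w : 0 < n -> full n w -> exists2 v, w = n :: v & active n n (fun _ => 0) v.
Proof.
move=> n0 [sz lw cw]; case: w sz lw cw => [|x w] sz lw cw; first by have := cw n; rewrite n0 leqnn => /(_ isT) /=; lia.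
have [xn h lw'] := lattice_step lw.
have E : x = n.
  apply/eqP; rewrite eqn_leq; case/andP: (xn) => x0 -> /=; rewrite leqNgt; apply/negP => xn'.
  by have := h x; rewrite x0 xn' /incr eqxx (_ : (x.+1 == x) = false) => [/(_ isT)|]; lia.
by rewrite E in h lw' *; exists w => //; split; rewrite ?n0 ?leqnn.
Qed.

Lemma promote_full n w : 0 < n -> full n w ->
  exists v u, [/\ w = n :: v, crystal_ebar n v = Some u, full n (rcons u 1) &
    promote_boxes (0, 0) (sqboxes n (incr (fun _ => 0) n) v) = sqboxes n (fun _ => 0) (rcons u 1)].
Proof.
move=> n0 fw; have [v E G] := full_head n0 fw; have [sz lw cw] := fw.
have e0 : addw (fun _ => 0) [::] = fun _ => 0 by rewrite addw_nil.
have := @scan_crystal n n [::] v isT; rewrite e0 => /(_ G)[|u su hu].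
  by move=> b bn; rewrite -addw_cons -E /addw cw.
have pm : perm_eq w (rcons u 1) by rewrite -su E scan_perm.
exists v, u; split=> //; last by have := promote_scan G; rewrite subnn su.
split; first by rewrite -(perm_size pm).
  by rewrite -su; apply: scan_lattice.
by move=> a an; rewrite -(permP pm) cw.
Qed.

Lemma wcont_promote n v w' : 0 < n -> lattice n (fun _ => 0) (n :: v) -> lattice n (fun _ => 0) w' ->
  promote_boxes (0, 0) (sqboxes n (incr (fun _ => 0) n) v) = sqboxes n (fun _ => 0) w' ->
  wcont (fun _ => 0) (n :: v) = n.-1 :: wcont (incr (fun _ => 0) n) v /\
  wcont (fun _ => 0) w' = jdt n.-1 (wcont (incr (fun _ => 0) n) v).
Proof.
move=> n0 lw lw' e; have [b1 v1] := wcont_spec n0 lw; have [b2 _] := wcont_spec n0 lw'.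
have ew : wcont (fun _ => 0) (n :: v) = n.-1 :: wcont (incr (fun _ => 0) n) v.
  by rewrite /= addn0.
split=> //; rewrite ew in b1 v1; move: v1; rewrite valid_cat => /andP[_ v1].
set m := addw _ (stair n.-1) in b1 b2 v1; apply: (@boxes_inj m).
have m0 : m n.-1 = 0 by rewrite /m /addw stair_count subnn.
by case: b1 => _ _ b1; rewrite b2 boxes_jdt // b1 -e -promote_boxes_shift m0.

Qed.

Lemma haiman_full n w : 0 < n -> full n w ->
  haiman n (fill (sqboxes n (fun _ => 0) w)) = fill (boxes (fun _ => 0) (level_hops n w)).
Proof.
move=> n0 [sz lw cw]; have [b v] := wcont_spec n0 lw; have [e _ _] := level_hops_spec n0 lw.
rewrite /haiman haiman_skew_fill haiman_inner_cellsE -b foldl_slide ?e //.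
by rewrite -sz -(size_boxes (addw (fun _ => 0) (stair n.-1))) b size_map size_sqboxes.
Qed.

Lemma mixed_full n w : 0 < n -> full n w ->
  mixed_Q w = fill (boxes (fun _ => 0) (level_hops n w)).
Proof. by move=> n0 [_ lw _]; rewrite (mixed_Q_fill lw); have [_ _ ->] := level_hops_spec n0 lw. Qed.

Lemma promotion_full n v w' : 0 < n -> full n (n :: v) -> full n w' ->
  promote_boxes (0, 0) (sqboxes n (incr (fun _ => 0) n) v) = sqboxes n (fun _ => 0) w' ->
  promotion (n ^ 2) (fill (sqboxes n (fun _ => 0) (n :: v))) = fill (sqboxes n (fun _ => 0) w') /\
  promotion (n ^ 2) (fill (boxes (fun _ => 0) (level_hops n (n :: v)))) =
    fill (boxes (fun _ => 0) (level_hops n w')).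
Proof.
move=> n0 [sz lw cw] [sz' lw' cw'] e; have [e1 e2] := wcont_promote n0 lw lw' e.
have [b vd] := wcont_spec n0 lw; split.
  rewrite -e -promotion_fill_promote; first by rewrite size_sqboxes -sz /= subnn.
  have : linear (sqboxes n (fun _ => 0) (n :: v)).
    by rewrite -(linear_shift n) -b; apply: boxes_linear; move: vd; rewrite valid_cat => /andP[].
  by rewrite /= subnn.
have [|x [t [h1 h2]]] := level_hops_promotion n0 vd lw lw' cw cw'.
  by exists (wcont (incr (fun _ => 0) n) v).
have [_ vl _] := level_hops_spec n0 lw; rewrite h1 in vl.
have x0 : x = 0 by move: vl => /=; case: (x).
rewrite {}x0 in h1 h2 vl; have := promotion_fill_promote (boxes_linear vl).
have <- : size (0 :: t) = n ^ 2 by rewrite -h1 /level_hops size_conts size_hrows.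
by rewrite h1 h2 boxes_jdt // size_boxes.
Qed.

(** * Square words and standard tableaux of square shape *)

Lemma latticeP n c w : all (fun x => 0 < x <= n) w ->
  (forall i a, 0 < a < n -> addw c (take i w) a <= addw c (take i w) a.+1) -> lattice n c w.
Proof.
elim: w c => [//|x w IH] c /= /andP[-> al] h /=; apply/andP; split.
  apply/allP => a; rewrite mem_iota => an; have := h 1 a.
  by rewrite /= take0 addw_cons addw_nil; apply; lia.
by apply: IH => // i a an; have := h i.+1 a an; rewrite /= addw_cons.
Qed.

Lemma square_word_full n w : square_word n w -> full n w.
Proof.
by move=> [sz al cw pre]; split=> //; apply: latticeP => // i a an; apply: pre.
Qed.

Lemma SYT_boxes n Q : is_SYT_square n Q ->
  exists2 bs, size bs = n ^ 2 & forall k, k < n ^ 2 -> 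
    Q (nth (0, 0) bs k).1 (nth (0, 0) bs k).2 = Some k.+1.
Proof.
move=> S; pose cells := [seq (i, j) | i <- iota 0 n, j <- iota 0 n].
pose p k := nth (0, 0) cells (find (fun q => Q q.1 q.2 == Some k.+1) cells).
exists (mkseq p (n ^ 2)) => [|k kn]; rewrite ?size_mkseq // nth_mkseq //.
have [|i [j e]] := standard_surj S (k := k.+1); first by rewrite ltnS.
have hs : has (fun q => Q q.1 q.2 == Some k.+1) cells.
  apply/hasP; exists (i, j); rewrite /= ?e //; apply/allpairsP; exists (i, j).
  have := standard_shape S i j; rewrite e /= => /esym/andP[].
  by rewrite !mem_iota /= !add0n => -> ->.
by apply/eqP; apply: (nth_find (0, 0) hs).
Qed.

(* c a boxes of row n - a have a label <= k *)
Definition rows_upto (n : nat) (Q : filling) (k : nat) (c : nat -> nat) : Prop :=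
  forall i j, i < n -> (exists2 l, l <= k & Q i j = Some l) <-> j < c (n - i).

Lemma SYT_word n Q bs k c : is_SYT_square n Q -> k + size bs = n ^ 2 ->
  (forall l, l < size bs -> Q (nth (0, 0) bs l).1 (nth (0, 0) bs l).2 = Some (k + l).+1) ->
  rows_upto n Q k c -> let w := [seq n - q.1 | q <- bs] in
  [/\ sqboxes n c w = bs, lattice n c w & rows_upto n Q (n ^ 2) (addw c w)].
Proof.
move=> S; elim: bs k c => [|[r j] bs IH] k c /=.
  by rewrite addn0 => -> _; rewrite addw_nil; split.
move=> sz h up; have q := h 0 isT; rewrite /= addn0 in q.
have [rn jn] : r < n /\ j < n.
  by have := standard_shape S r j; rewrite q => /esym/andP[].
have some i j' : i < n -> j' < n -> exists l, Q i j' = Some l.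
  move=> i_n j_n; have := standard_shape S i j'; rewrite i_n j_n.
  by case: (Q i j') => // l _; exists l.
have cj : c (n - r) = j.
  apply/eqP; rewrite eqn_leq; apply/andP; split.
    rewrite leqNgt; apply/negP => /(up r j rn)[l lk]; rewrite q => -[E]; lia.
  clear h; case: j q jn => [//|j] q jn; have [l e] := some r j rn (ltnW jn).
  have := standard_row S e q; rewrite ltnS => lk.
  by apply/(up r j rn); exists l.
have up' : rows_upto n Q k.+1 (incr c (n - r)).
  move=> i j' i_n; rewrite /incr; have [E|ne] := eqVneq i r.
    rewrite E eqxx cj addn1 ltnS leq_eqVlt; split=> [[l]|/orP[/eqP->|]].
    - rewrite leq_eqVlt => /orP[/eqP->|]; last first.
        by rewrite ltnS => lk e; have := (up r j' rn).1; rewrite cj => -> ; rewrite ?orbT //; exists l.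
      by move=> /(standard_inj S q)[_ <-]; rewrite eqxx.
    - by exists k.+1.
    by move=> j'j; have := (up r j' rn).2; rewrite cj => /(_ j'j)[l lk e]; exists l => //; apply: leqW.
  rewrite (_ : (n - i == n - r) = false) ?addn0; last by lia.
  rewrite -(up i j' i_n); split=> -[l lk e]; exists l => //; last exact: leqW.
  move: lk; rewrite leq_eqVlt => /orP[/eqP E|//].
  by move: e; rewrite E => /(standard_inj S q)[E' _]; move: ne; rewrite E' eqxx.
have [|l lb||e1 e2 e3] := IH k.+1 (incr c (n - r)); rewrite ?addSnnS //.
  by have := h l.+1 lb.
split; last by rewrite addw_cons.
  by rewrite e1 subKn ?cj // ltnW.
rewrite e2 andbT; apply/andP; split; first by lia.
apply/allP => a; rewrite mem_iota => an.
have a_n : 0 < a < n by lia.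
have an1 : n - a < n by lia.
have an2 : n - a.+1 < n by lia.
(* If row [n - a] were longer than the row above it, the box above its box in column
   [incr c (n - r) a.+1] would carry a smaller label that is not yet counted. *)
rewrite leqNgt; apply/negP => lt.
have E1 : n - (n - a) = a by lia.
have E2 : n - (n - a.+1) = a.+1 by lia.
have E3 : n - a = (n - a.+1).+1 by lia.
have [l lk e] := (up' (n - a) (incr c (n - r) a.+1) an1).2 ltac:(by rewrite E1).
have hj : incr c (n - r) a.+1 < n.
  by have := standard_shape S (n - a) (incr c (n - r) a.+1); rewrite e => /esym/andP[].
have [l' e'] := some _ _ an2 hj.
rewrite E3 in e; have ll' := standard_col S e' e.
suff : incr c (n - r) a.+1 < incr c (n - r) (n - (n - a.+1)) by rewrite E2 ltnn.
by apply/(up' _ _ an2); exists l' => //; apply: leq_trans lk; apply: ltnW.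
Qed.

Lemma SYT_full n Q : is_SYT_square n Q ->
  exists2 w, full n w & Q = fill (sqboxes n (fun _ => 0) w).
Proof.
move=> S; have [bs sz h] := SYT_boxes S.
have [//||i j i_n|e1 e2 e3] := @SYT_word n Q bs 0 (fun _ => 0) S.
- by move=> l; rewrite sz; apply: h.
- split=> // -[l l0 e]; have := standard_range S e; lia.
exists [seq n - q.1 | q <- bs].
  split; rewrite ?size_map // => a an.
  have := e3 (n - a); rewrite (_ : n - (n - a) = a); last by lia.
  rewrite /addw add0n => h3; have an' : n - a < n by lia.
  apply/eqP; rewrite eqn_leq; apply/andP; split; rewrite leqNgt; apply/negP.
    move=> /(h3 _ an')[l _ e]; have := standard_shape S (n - a) n.
    by rewrite e ltnn andbF.
  move=> lt; have := standard_shape S (n - a) (count_mem a [seq n - q.1 | q <- bs]).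
  rewrite an' lt; case e: (Q _ _) => [l|//] _.
  suff : count_mem a [seq n - q.1 | q <- bs] < count_mem a [seq n - q.1 | q <- bs].
    by rewrite ltnn.
  by apply/(h3 _ an'); exists l => //; case/andP: (standard_range S e).
rewrite e1; apply: filling_ext => i j; rewrite /fill.
have u : forall k, k < n ^ 2 -> forall k', k' < n ^ 2 -> nth (0, 0) bs k = nth (0, 0) bs k' -> k = k'.
  by move=> k kn k' kn' E; have := h k kn; rewrite E h // => -[].
case: ifP => [hij|].
  have ix : index (i, j) bs < n ^ 2 by rewrite -sz index_mem.
  by have := h _ ix; rewrite nth_index.
move=> hij; case e: (Q i j) => [k|//].
have /andP[k0 kn] := standard_range S e; have := h k.-1; rewrite prednK // => /(_ kn) e'.
have [E1 E2] := standard_inj S e e'; move: hij.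
by rewrite E1 E2 -surjective_pairing mem_nth // sz prednK.
Qed.

Theorem theorem3p6 (n : nat) (hn : 1 <= n) :
  (forall w : seq nat, square_word n w ->
     exists u : seq nat,
       [/\ crystal_ebar n (behead w) = Some u,
           promotion (n ^ 2) (RSK_Q w) =2 RSK_Q (rcons u 1)
         & promotion (n ^ 2) (mixed_Q w) =2 mixed_Q (rcons u 1)])
  /\
  (forall Q : filling, is_SYT_square n Q ->
     promotion (n ^ 2) (haiman n Q) =2 haiman n (promotion (n ^ 2) Q)).
Proof.
split=> [w /square_word_full fw|Q /SYT_full[w fw ->]].
  have [v [u [E hu fu e]]] := promote_full hn fw; exists u.
  rewrite (mixed_full hn fw) (mixed_full hn fu).
  have [_ lw _] := fw; have [_ lu _] := fu.
  rewrite (RSK_Q_fill lw) (RSK_Q_fill lu) {}E in fw *.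
  by have [-> ->] := promotion_full hn fw fu e.
have [v [u [E _ fu e]]] := promote_full hn fw; rewrite {}E in fw *.
have [h1 h2] := promotion_full hn fw fu e.
by rewrite h1 !haiman_full // h2.
Qed.
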